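(* There is a polynomial-time algorithm that, given a graph $G$ and a set $F\subseteq E(G)$, either correctly decides whether $G$ has a bipartizing matching disjoint from $F$, or outputs a graph $G'$ and a set $F'\subseteq E(G')$ with $|V(G')|\le 2\cdot nd(G)$ such that $G$ has a bipartizing matching disjoint from $F$ if and only if $G'$ has a bipartizing matching disjoint from $F'$. In particular (taking $F=\emptyset$), the problem of deciding whether $G$ has a bipartizing matching admits a kernel with at most $2\cdot nd(G)$ vertices when parameterized by the neighborhood diversity (the kernel being an instance of the generalized problem with forbidden edges).
   Context: A matching $M\subseteq E(G)$ is a bipartizing matching of $G$ if the graph $(V(G),E(G)\setminus M)$ is bipartite. $G$ has neighborhood diversity $nd(G)=t$ if $t$ is the minimum number such that $V(G)$ can be partitioned into $t$ sets $V_1,\dots,V_t$ where, for every vertex $v$ and every $i$, $v$ is adjacent either to every vertex of $V_i\setminus\{v\}$ or to none of them (each $V_i$ is then a clique or an independent set). *)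

(* Defs.v *)
From mathcomp Require Import all_boot.
Set Implicit Arguments. Unset Strict Implicit. Unset Printing Implicit Defensive.

(* A (finite, simple) graph on vertex set 'I_n is a symmetric irreflexive
   boolean adjacency relation. Edge sets (such as F, M) are symmetric
   relations contained in the adjacency relation (an unordered edge {x,y}
   is represented by both (x,y) and (y,x)). *)
Definition simple_graph n (adj : rel 'I_n) : Prop :=
  (forall x y, adj x y = adj y x) /\ (forall x, adj x x = false).

Definition edge_subset n (adj : rel 'I_n) (F : rel 'I_n) : Prop :=
  (forall x y, F x y = F y x) /\ (forall x y, F x y -> adj x y).

Definition is_matching n (adj M : rel 'I_n) : Prop :=
  edge_subset adj M /\ (forall x y z, M x y -> M x z -> y = z).

Definition bipartite_minus n (adj M : rel 'I_n) : Prop :=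
  exists col : 'I_n -> bool, forall x y, adj x y -> ~~ M x y -> col x != col y.

Definition has_bip_matching_avoiding n (adj F : rel 'I_n) : Prop :=
  exists M : rel 'I_n, is_matching adj M /\ bipartite_minus adj M /\
    (forall x y, M x y -> ~~ F x y).

(* t classes (given by f : V -> 'I_t, classes may be empty) such that every
   vertex v is adjacent to all or none of V_i \ {v}. *)
Definition nd_part n (adj : rel 'I_n) (t : nat) : bool :=
  [exists f : {ffun 'I_n -> 'I_t},
     [forall v, [forall u, [forall w,
        ((f u == f w) && (u != v) && (w != v)) ==> (adj v u == adj v w)]]]].

Lemma nd_part_exists n (adj : rel 'I_n) : exists t, nd_part adj t.
Proof.
exists n; apply/existsP; exists [ffun x => x].
apply/forallP => v; apply/forallP => u; apply/forallP => w.
by rewrite !ffunE; apply/implyP => /andP [/andP [/eqP -> _] _].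
Qed.

Definition nd n (adj : rel 'I_n) : nat := ex_minn (nd_part_exists adj).

Definition sym := 'I_4.
Definition sBlank : sym := @Ordinal 4 0 isT.
Definition s0 : sym := @Ordinal 4 1 isT.
Definition s1 : sym := @Ordinal 4 2 isT.
Definition sSep : sym := @Ordinal 4 3 isT.

(* States 'I_(tm_nstates.+1); start state is ord0, the unique halting state
   is ord_max. Moves: 0 = left, 1 = stay, 2 = right. *)
Record TM := {
  tm_nstates : nat;
  tm_delta : 'I_tm_nstates.+1 -> sym -> 'I_tm_nstates.+1 * sym * 'I_3 }.

(* configuration: state, left part of tape (reversed, nearest first),
   head symbol, right part of tape *)
Definition config (M : TM) := ('I_(tm_nstates M).+1 * seq sym * sym * seq sym)%type.

Definition tm_step (M : TM) (c : config M) : config M :=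
  let: (q, l, h, r) := c in
  if q == ord_max then c else
  let: (q', s, mv) := tm_delta q h in
  if val mv == 0 then (q', behead l, head sBlank l, s :: r)
  else if val mv == 1 then (q', l, s, r)
  else (q', s :: l, head sBlank r, behead r).

Definition tm_init (M : TM) (w : seq sym) : config M :=
  (ord0, [::], head sBlank w, behead w).

Definition tm_output (M : TM) (c : config M) : seq sym :=
  let: (_, _, h, r) := c in take (find (pred1 sBlank) (h :: r)) (h :: r).

Definition tm_halts_with (M : TM) (w : seq sym) (t : nat) (out : seq sym) : Prop :=
  let c := iter t (@tm_step M) (tm_init M w) in
  c.1.1.1 = ord_max /\ tm_output c = out.

Definition enc_rel n (R : rel 'I_n) : seq sym :=
  [seq (if R i j then s1 else s0) | i <- enum 'I_n, j <- enum 'I_n].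

Definition enc_instance n (adj F : rel 'I_n) : seq sym :=
  nseq n s1 ++ sSep :: enc_rel adj ++ sSep :: enc_rel F.

(* Main.v *)
Require Import Defs.
From mathcomp Require Import all_boot zify.
From Stdlib Require Import FunctionalExtensionality.
Set Implicit Arguments. Unset Strict Implicit. Unset Printing Implicit Defensive.

(* A graph has a bipartizing matching avoiding F iff its vertices have a
   2-colouring in which every vertex has at most one neighbour of its own colour
   and no edge of F is monochromatic.  Let C be a class of twins with at least
   three vertices.  If C is independent, two of its vertices share a colour, so
   all neighbours of C have the other colour; hence two vertices of C suffice
   once all edges at C are forbidden.  If C is a clique, then C together with its
   neighbourhood has at most four vertices and splits into two colour classes of
   size at most two; this is checked directly, and a neighbour outside C is
   matched into C, which two vertices of C joined by a forbidden edge express.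
   Keeping the first two vertices of every class thus gives the kernel.

   Everything in this reduction is first-order definable over (adj, F, <), and a
   one-tape machine evaluates a fixed first-order formula in polynomial time: the
   input is already a sequence of bit strings separated by [sSep], which serve as
   stacks next to unary registers for the variables.  The output is the
   last three stacks. *)

(** * Structured tape programs *)

(** Why four: in a valid colouring two of three vertices of a clique class share a colour, so the
    rest of their closed neighbourhood has the other colour; a third class vertex is adjacent to all
    of that rest and tolerates only one more vertex in it. With three places taken by the class, at
    most one neighbour lies outside. This makes the check local. A clique class meets the rest of
    the graph only through that single outer neighbour, and swapping the two colours on the class
    adapts any admissible splitting to the colour the neighbour has elsewhere. For the rest of the
    graph all that matters is that the neighbour has spent its one partner on the class. Two kept
    vertices forced to differ say exactly this, since the neighbour agrees with one of them.
    Forbidden edges are thus needed in the kernel even when [F] is empty. Logic replaces data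
    structures on the machine side: twin classes are never computed, only tested by quantifiers, and
    the order on vertices picks the representatives. The running time is a polynomial whose degree
    depends only on the fixed formulas. *)

Definition tape := (seq sym * seq sym)%type.
Definition scanned (tp : tape) : sym := head sBlank tp.2.
Definition tmove := 'I_3.
Definition mvL : tmove := @Ordinal 3 0 isT.
Definition mvS : tmove := @Ordinal 3 1 isT.
Definition mvR : tmove := @Ordinal 3 2 isT.

Definition tape_act (f : sym -> sym * tmove) (tp : tape) : tape :=
  let: (l, r) := tp in
  let: (s, mv) := f (head sBlank r) in
  if val mv == 0 then (behead l, head sBlank l :: s :: behead r)
  else if val mv == 1 then (l, s :: behead r)
  else (s :: l, behead r).

(* [TWhile p P q] runs [p], then tests the scanned symbol: on success it runs
   [q] and starts again. *)
Inductive tprog :=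
| TAct of (sym -> sym * tmove)
| TSeq of tprog & tprog
| TIf of pred sym & tprog & tprog
| TWhile of tprog & pred sym & tprog.

(** The time charged is that of the compiled code: a test costs one step, the branch taken on
    success pays one more for jumping over the other branch, and each round of a loop pays one for
    jumping back. *)
Inductive texec : tprog -> tape -> nat -> tape -> Prop :=
| XAct f tp : texec (TAct f) tp 1 (tape_act f tp)
| XSeq p q tp t tp1 t' tp2 :
    texec p tp t tp1 -> texec q tp1 t' tp2 -> texec (TSeq p q) tp (t + t') tp2
| XIfT (P : pred sym) p q tp t tp1 : P (scanned tp) ->
    texec p tp t tp1 -> texec (TIf P p q) tp (t.+1 + 1) tp1
| XIfF (P : pred sym) p q tp t tp1 : ~~ P (scanned tp) ->
    texec q tp t tp1 -> texec (TIf P p q) tp t.+1 tp1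
| XWhileT p (P : pred sym) q tp t tp1 t' tp2 t'' tp3 :
    texec p tp t tp1 -> P (scanned tp1) -> texec q tp1 t' tp2 ->
    texec (TWhile p P q) tp2 t'' tp3 ->
    texec (TWhile p P q) tp (t + (t'.+1 + t''.+1)) tp3
| XWhileF p (P : pred sym) q tp t tp1 :
    texec p tp t tp1 -> ~~ P (scanned tp1) -> texec (TWhile p P q) tp (t + 1) tp1.

(** * Compilation of tape programs to Turing machines *)

Definition instr := sym -> nat * sym * tmove.
Definition ijump (k : nat) : instr := fun s => (k, s, mvS).
Definition ibranch (P : pred sym) (k k' : nat) : instr :=
  fun s => (if P s then k else k', s, mvS).

Fixpoint tlen (p : tprog) : nat :=
  match p with
  | TAct _ => 1
  | TSeq p q => tlen p + tlen q
  | TIf _ p q => (tlen p).+2 + tlen q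
  | TWhile p _ q => (tlen p + tlen q).+2
  end.

Fixpoint tcode (p : tprog) (o : nat) : seq instr :=
  match p with
  | TAct f => [:: fun s => (o.+1, (f s).1, (f s).2)]
  | TSeq p q => tcode p o ++ tcode q (o + tlen p)
  | TIf P p q =>
      ibranch P o.+1 (o + (tlen p).+2) :: tcode p o.+1 ++
        ijump (o + ((tlen p).+2 + tlen q)) :: tcode q (o + (tlen p).+2)
  | TWhile p P q =>
      tcode p o ++ ibranch P (o + (tlen p).+1) (o + (tlen p + tlen q).+2)
        :: tcode q (o + (tlen p).+1) ++ [:: ijump o]
  end.

Lemma size_tcode p o : size (tcode p o) = tlen p.
Proof.
elim: p o => [f|p IHp q IHq|P p IHp q IHq|p IHp P q IHq] o //=;
  rewrite ?size_cat /= ?size_cat /= ?IHp ?IHq //; lia.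
Qed.

(** States are instruction addresses, and the address just past the last instruction is [ord_max]:
    running off the end of the code is halting. *)
Definition tm_of_code (c : seq instr) : TM :=
  {| tm_nstates := size c;
     tm_delta := fun q h =>
       let: (k, s, mv) := nth (ijump 0) c q h in (inord k, s, mv) |}.

Definition cfg (c : seq instr) (k : nat) (tp : tape) : config (tm_of_code c) :=
  (inord k, tp.1, head sBlank tp.2, behead tp.2).

Lemma tm_step_act c k f tp o : k < size c -> o <= size c ->
  nth (ijump 0) c k = (fun s => (o, (f s).1, (f s).2)) ->
  tm_step (cfg c k tp) = cfg c o (tape_act f tp).
Proof.
move=> ks os ck; case: tp => l r; rewrite /cfg /tm_step /=.
have nk : (inord k : 'I_(size c).+1) != ord_max.
  by apply/eqP => h; have := congr1 val h; rewrite /= inordK; lia.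
rewrite (negbTE nk) inordK; last by lia.
rewrite ck; case: (f _) => s mv /=.
by case: eqP => _ //=; case: eqP.
Qed.

Definition subcode (c : seq instr) (o : nat) (d : seq instr) : Prop :=
  exists2 c', c = take o c ++ d ++ c' & o <= size c.

Lemma subcode_catl c o d d' : subcode c o (d ++ d') -> subcode c o d.
Proof. by case=> c' e os; exists (d' ++ c') => //; rewrite [LHS]e -!catA. Qed.

Lemma subcode_catr c o d d' :
  subcode c o (d ++ d') -> subcode c (o + size d) d'.
Proof.
case=> c' e os.
have eo : size (take o c) = o by rewrite size_takel.
have et : take (o + size d) c = take o c ++ d.
  by rewrite [in LHS]e -catA catA take_size_cat // size_cat eo.
exists c'; first by rewrite et [LHS]e -!catA.
by rewrite [in leqRHS]e !size_cat eo; lia.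
Qed.

Lemma subcode_cons c o i d : subcode c o (i :: d) ->
  [/\ nth (ijump 0) c o = i, o < size c & subcode c o.+1 d].
Proof.
rewrite -cat1s => h; have h1 := subcode_catr h; rewrite addn1 in h1.
case: h => c' e os; have eo : size (take o c) = o by rewrite size_takel.
split=> //; first by rewrite e nth_cat eo ltnn subnn.
by rewrite [in ltnRHS]e !size_cat eo /=; lia.
Qed.

Lemma subcode_le c o d : subcode c o d -> o + size d <= size c.
Proof.
by case=> c' e os; rewrite [in leqRHS]e !size_cat size_takel //; lia.
Qed.

Lemma iterSD T (f : T -> T) m n x : iter (m + n) f x = iter n f (iter m f x).
Proof. by rewrite addnC iterD. Qed.

(** On an empty right half, staying writes an explicit blank, so the tapes may differ; the
    configurations agree because [cfg] pads the scanned symbol with a blank anyway. *)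
Lemma tact_stay tp c k :
  cfg c k (tape_act (fun s => (s, mvS)) tp) = cfg c k tp.
Proof. by case: tp => l [|x r]. Qed.

Lemma step_jump c k o tp : k < size c -> o <= size c ->
  nth (ijump 0) c k = ijump o -> tm_step (cfg c k tp) = cfg c o tp.
Proof.
move=> ks os e; rewrite (@tm_step_act c k (fun s => (s, mvS)) tp o) //.
exact: tact_stay.
Qed.

Lemma step_branch c k (P : pred sym) o o' tp :
  k < size c -> o <= size c -> o' <= size c ->
  nth (ijump 0) c k = ibranch P o o' ->
  tm_step (cfg c k tp) = cfg c (if P (scanned tp) then o else o') tp.
Proof.
move=> ks os os' e; case: tp => l r; rewrite /cfg /tm_step /=.
have nk : (inord k : 'I_(size c).+1) != ord_max.
  by apply/eqP => h; have := congr1 val h; rewrite /= inordK; lia.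
by rewrite (negbTE nk) inordK ?e /= //; lia.
Qed.

Lemma texec_tm p tp t tp' : texec p tp t tp' ->
  forall c o, subcode c o (tcode p o) ->
  iter t (@tm_step (tm_of_code c)) (cfg c o tp) = cfg c (o + tlen p) tp'.
Proof.
elim=> {p tp t tp'}
  [f tp|p q tp t tp1 t' tp2 _ IHp _ IHq|P p q tp t tp1 Pt _ IHp
  |P p q tp t tp1 Pt _ IHq
  |p P q tp t tp1 t' tp2 t'' tp3 _ IHp Pt _ IHq _ IHw
  |p P q tp t tp1 _ IHp Pt] c o sc; rewrite /= in sc.
- have [e ks _] := subcode_cons sc; rewrite addn1 /=.
  exact: (tm_step_act (f := f)).
- rewrite iterSD (IHp _ _ (subcode_catl sc)).
  have := subcode_catr sc; rewrite size_tcode => sc'.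
  by rewrite (IHq _ _ sc') addnA.
- have le := subcode_le sc; have [e ks sc1] := subcode_cons sc.
  have h := subcode_catr sc1; have [e' ks' _] := subcode_cons h.
  rewrite size_tcode in e' ks'.
  rewrite /= size_cat /= !size_tcode in le.
  rewrite (iterSD _ t.+1 1) (iterSr t) (step_branch _ _ _ _ e) //; try lia.
  rewrite Pt (IHp _ _ (subcode_catl sc1)) /=.
  by apply: (step_jump _ _ _ e'); lia.
- have le := subcode_le sc; have [e ks sc1] := subcode_cons sc.
  have h := subcode_catr sc1; have [_ _ sc2] := subcode_cons h.
  rewrite /= size_cat /= !size_tcode in le.
  rewrite iterSr (step_branch _ _ _ _ e) //; try lia.
  rewrite (negbTE Pt); rewrite size_tcode in sc2.
  have eo : (o.+1 + tlen p).+1 = o + (tlen p).+2 by lia.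
  by rewrite eo in sc2; rewrite (IHq _ _ sc2) /= addnA.
- have le := subcode_le sc; have h := subcode_catr sc.
  have [e ks sc1] := subcode_cons h; have h2 := subcode_catr sc1.
  have [e' ks' _] := subcode_cons h2.
  rewrite !size_tcode in e ks sc1 e' ks'.
  rewrite /= !size_cat /= size_cat /= !size_tcode in le.
  rewrite iterSD (IHp _ _ (subcode_catl sc)) iterSD.
  rewrite (iterSr t').
  rewrite (step_branch _ _ _ _ e) //; try lia.
  rewrite Pt; rewrite -addnS in sc1 e'; rewrite (IHq _ _ (subcode_catl sc1)).
  by rewrite iterSr (step_jump _ _ _ e') ?(IHw _ _ sc) //; lia.
- have le := subcode_le sc; have h := subcode_catr sc.
  have [e ks sc1] := subcode_cons h.
  rewrite !size_tcode in e ks sc1.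
  rewrite /= !size_cat /= size_cat /= !size_tcode in le.
  rewrite iterSD (IHp _ _ (subcode_catl sc)) iterS [iter 0 _ _]/=.
  rewrite (step_branch _ _ _ _ e) //; try lia.
  by rewrite (negbTE Pt).
Qed.

Lemma tm_of_tprog (p : tprog) : exists M : TM,
  forall w t tp, texec p ([::], w) t tp ->
    tm_halts_with M w t (take (find (pred1 sBlank) (scanned tp :: behead tp.2))
                              (scanned tp :: behead tp.2)).
Proof.
exists (tm_of_code (tcode p 0)) => w t tp ex.
have sc : subcode (tcode p 0) 0 (tcode p 0).
  by exists [::]; rewrite // take0 cats0.
have e0 : tm_init (tm_of_code (tcode p 0)) w = cfg (tcode p 0) 0 ([::], w).
  rewrite /tm_init /cfg; congr (_, _, _, _).
  by apply: val_inj; rewrite /= inordK.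
rewrite /tm_halts_with e0 (texec_tm ex sc); split=> //.
by apply: val_inj; rewrite /= inordK size_tcode.
Qed.

(** Recording only an upper bound on the time lets bounds be rounded up at every composition. *)
Definition trun p tp T tp' := exists2 t, t <= T & texec p tp t tp'.

Lemma trun_le p tp T T' tp' : T <= T' -> trun p tp T tp' -> trun p tp T' tp'.
Proof. by move=> le [t tT ex]; exists t => //; apply: leq_trans le. Qed.

Lemma trun_act f tp : trun (TAct f) tp 1 (tape_act f tp).
Proof. by exists 1 => //; constructor. Qed.

Lemma trun_seq p q tp T tp1 T' tp2 :
  trun p tp T tp1 -> trun q tp1 T' tp2 -> trun (TSeq p q) tp (T + T') tp2.
Proof.
move=> [t tT ex] [t' tT' ex']; exists (t + t'); first by lia.
exact: XSeq ex ex'.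
Qed.

Lemma trun_if (P : pred sym) p q tp T tp1 :
  (if P (scanned tp) then trun p tp T tp1 else trun q tp T tp1) ->
  trun (TIf P p q) tp T.+2 tp1.
Proof.
case: ifP => Pt [t tT ex].
  by exists (t.+1 + 1); [lia | apply: XIfT].
by exists t.+1; [lia | apply: XIfF => //; rewrite Pt].
Qed.

Lemma trun_whileT p (P : pred sym) q tp T tp1 T' tp2 T'' tp3 :
  trun p tp T tp1 -> P (scanned tp1) -> trun q tp1 T' tp2 ->
  trun (TWhile p P q) tp2 T'' tp3 ->
  trun (TWhile p P q) tp (T + (T'.+1 + T''.+1)) tp3.
Proof.
move=> [t tT ex] Pt [t' tT' ex'] [t'' tT'' ex''].
exists (t + (t'.+1 + t''.+1)); first by lia.
exact: XWhileT ex Pt ex' ex''.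
Qed.

Lemma trun_whileF p (P : pred sym) q tp T tp1 :
  trun p tp T tp1 -> ~~ P (scanned tp1) -> trun (TWhile p P q) tp T.+1 tp1.
Proof.
move=> [t tT ex] Pt; exists (t + 1); first by lia.
exact: XWhileF.
Qed.

Definition goL := TAct (fun s => (s, mvL)).
Definition goR := TAct (fun s => (s, mvR)).
Definition stay := TAct (fun s => (s, mvS)).
Definition wr s mv := TAct (fun _ => (s, mv)).
Lemma goLP x l y r : trun goL (x :: l, y :: r) 1 (l, x :: y :: r).
Proof. exact: trun_act. Qed.
Lemma goRP l x r : trun goR (l, x :: r) 1 (x :: l, r).
Proof. exact: trun_act. Qed.
Lemma stayP l x r : trun stay (l, x :: r) 1 (l, x :: r).
Proof. exact: trun_act. Qed.
Lemma wrLP s x l y r : trun (wr s mvL) (x :: l, y :: r) 1 (l, x :: s :: r).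
Proof. exact: trun_act. Qed.
Lemma wrSP s l y r : trun (wr s mvS) (l, y :: r) 1 (l, s :: r).
Proof. exact: trun_act. Qed.
Lemma wrRP s l y r : trun (wr s mvR) (l, y :: r) 1 (s :: l, r).
Proof. exact: trun_act. Qed.

Fixpoint trep n p := if n is n'.+1 then TSeq p (trep n' p) else stay.

Definition bit (b : bool) : sym := if b then s1 else s0.
Definition unbit (s : sym) : option bool :=
  if s == s1 then Some true else if s == s0 then Some false else None.

(** * Moving and shifting segments of the tape *)

Definition seg (s : seq bool) : seq sym := sSep :: map bit s.

Lemma nosep_bits s : all (predC1 sSep) (map bit s).
Proof. by rewrite all_map; apply/allP => -[]. Qed.
Lemma noblank_bits s : all (predC1 sBlank) (map bit s).
Proof. by rewrite all_map; apply/allP => -[]. Qed.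

Definition toSep := TWhile goR (predC1 sSep) stay.
Definition toBlank := TWhile goL (predC1 sBlank) stay.

Lemma toSepP (l : seq sym) (x : sym) (p r : seq sym) : all (predC1 sSep) p ->
  trun toSep (l, x :: p ++ sSep :: r) (4 * size p + 2)
    (rev p ++ x :: l, sSep :: r).
Proof.
elim: p l x => [|y p IH] l x /=.
  by move=> _; apply: trun_whileF (goRP _ _ _) _.
case/andP=> yn /IH h; rewrite rev_cons cat_rcons.
apply: trun_le (trun_whileT (goRP _ _ _) yn (stayP _ _ _) (h _ _)); lia.
Qed.

(** The head stops on the blank in front of [p]. This uses up one of the [m] explicit blanks, or,
    for [m = 0], a fresh blank from beyond the end of the list; hence [m.-1]. *)
Lemma toBlankP m (p : seq sym) (x : sym) (r : seq sym) : all (predC1 sBlank) p ->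
  trun toBlank (rev p ++ nseq m sBlank, x :: r) (4 * size p + 2)
    (nseq m.-1 sBlank, sBlank :: p ++ x :: r).
Proof.
elim/last_ind: p x r => [|p y IH] x r.
  move=> _; apply: (@trun_whileF _ _ _ _ 1) => //.
  by have := trun_act (fun s => (s, mvL)) (nseq m sBlank, x :: r); case: m.
rewrite all_rcons rev_rcons size_rcons cat_rcons => /andP[yn /IH h].
apply: trun_le (trun_whileT (goLP _ _ _ _) yn (stayP _ _ _) (h _ _)); lia.
Qed.

(** A tape program cannot remember a symbol across a move, so carrying one takes a copy of the
    continuation per symbol. Blanks would fall into the separator case and are excluded in
    [bycaseP]. *)
Definition bycase (f : sym -> tprog) : tprog :=
  TIf (pred1 s0) (f s0) (TIf (pred1 s1) (f s1) (f sSep)).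

Lemma bycaseP f (s : sym) (l r : seq sym) T tp : s != sBlank ->
  trun (f s) (l, s :: r) T tp -> trun (bycase f) (l, s :: r) T.+4 tp.
Proof.
move=> sn h; apply: trun_if => /=; case: eqP => [e|n0].
  by rewrite -e; apply: trun_le h; lia.
apply: trun_if => /=; case: eqP => [e|n1]; first by rewrite -e.
suff -> : sSep = s by [].
by case: s sn n0 n1 {h} => -[|[|[|[|]]]] // lt ? /eqP ? /eqP ?; apply: val_inj.
Qed.

Definition shiftL :=
  bycase (fun s => TSeq goL (TSeq (wr s mvR) goR)).

Lemma shiftLP (y : sym) (l : seq sym) (s : sym) (r : seq sym) : s != sBlank ->
  trun shiftL (y :: l, s :: r) 7 (s :: s :: l, r).
Proof.
move=> sn; apply: (@bycaseP _ _ _ _ 3) => //.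
exact: (trun_seq (goLP _ _ _ _) (trun_seq (wrRP _ _ _ _) (goRP _ _ _))).
Qed.

Definition shift_seg := TWhile shiftL (predC1 sSep) stay.

(** Every symbol is copied onto its left neighbour. The cell [y] is lost, and the last cell keeps a
    stale copy, which the next shift or the caller overwrites. *)
Lemma shift_segP (y : sym) (l : seq sym) (s : sym) (p r : seq sym) : s != sBlank ->
  all (predC1 sSep) p -> all (predC1 sBlank) p ->
  trun shift_seg (y :: l, s :: p ++ sSep :: r) (10 * (size p).+1)
    (last s p :: rev p ++ s :: l, sSep :: r).
Proof.
elim: p y l s => [|z p IH] y l s sn /=.
  move=> _ _; have h := shiftLP y l (sSep :: r) sn.
  by apply: trun_le (@trun_whileF _ (predC1 sSep) stay _ _ _ h isT).
case/andP=> zs ps /andP[zb pb]; rewrite rev_cons cat_rcons.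
have h := IH s (s :: l) z zb ps pb.
apply: trun_le (trun_whileT (shiftLP _ _ _ sn) zs (stayP _ _ _) h); lia.
Qed.

Definition copyR := bycase (fun s => TSeq goR (wr s mvL)).

Lemma copyRP (l : seq sym) (s y : sym) (r : seq sym) : s != sBlank ->
  trun copyR (l, s :: y :: r) 6 (l, s :: s :: r).
Proof.
move=> sn; apply: (@bycaseP _ _ _ _ 2) => //.
exact: (trun_seq (goRP _ _ _) (wrLP _ _ _ _ _)).
Qed.

Definition shift_back := TWhile goL (predC1 sBlank) copyR.

(** The mirror image of shifting left: [y] is overwritten, and the stale copy is now the first cell
    after the blank. *)
Lemma shift_backP (l p : seq sym) (y : sym) (r : seq sym) : all (predC1 sBlank) p ->
  trun shift_back (rev p ++ sBlank :: l, y :: r) (9 * size p + 2)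
    (l, sBlank :: head y p :: p ++ r).
Proof.
elim/last_ind: p y r => [|p z IH] y r.
  by move=> _; apply: trun_whileF (goLP _ _ _ _) _.
rewrite all_rcons rev_rcons size_rcons cat_rcons => /andP[zn /IH h].
have := trun_whileT (goLP _ _ y _) zn (copyRP _ _ _ zn) (h z (z :: r)).
have -> : head z p = head y (rcons p z) by case: (p).
by apply: trun_le; lia.
Qed.

Definition store := nat -> seq bool.
Definition upd (st : store) i s : store := fun j => if j == i then s else st j.

Definition segs (st : store) (js : seq nat) : seq sym :=
  flatten [seq seg (st j) | j <- js].

Lemma segs_cat st js js' : segs st (js ++ js') = segs st js ++ segs st js'.
Proof. by rewrite /segs map_cat flatten_cat. Qed.

Lemma noblank_segs st js : all (predC1 sBlank) (segs st js).
Proof.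
elim: js => //= j js IH; rewrite all_cat /= noblank_bits; exact: IH.
Qed.

Lemma segs_sep st js r : exists r', segs st js ++ sSep :: r = sSep :: r'.
Proof. case: js => [|j js]; first by exists r. by eexists. Qed.

Lemma toSep_segs st js l r :
  trun (trep (size js) toSep) (l, segs st js ++ sSep :: r)
    (4 * size (segs st js) + 1)
    (rev (segs st js) ++ l, sSep :: r).
Proof.
elim: js l => [|j js IH] l /=; first exact: stayP.
have [r' e] := segs_sep st js r.
have h := toSepP l sSep r' (nosep_bits (st j)); rewrite -e in h.
rewrite /segs /= -/(segs st js) -catA rev_cons rev_cat cat_rcons -catA.
apply: trun_le (trun_seq h (IH _)).
rewrite size_cat; lia.
Qed.

Lemma shift_segs st js y l r :
  exists y', trun (trep (size js) shift_seg) (y :: l, segs st js ++ sSep :: r)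
    (10 * size (segs st js) + 1)
    (y' :: rev (segs st js) ++ l, sSep :: r).
Proof.
elim: js y l => [|j js IH] y l /=; first by exists y; exact: stayP.
have [r' e] := segs_sep st js r.
have h := @shift_segP y l sSep _ r' isT (nosep_bits (st j)) (noblank_bits _).
rewrite -e in h.
have [y' h'] := IH (last sSep (map bit (st j))) (rev (map bit (st j)) ++ sSep :: l).
exists y'.
rewrite /segs /= -/(segs st js) -catA rev_cons rev_cat cat_rcons -catA.
apply: trun_le (trun_seq h h').
rewrite size_cat; lia.
Qed.

(** * Programs on stacks *)

(* Stacks are laid out by decreasing index, so that stacks 2, 1, 0 end the tape;
   the top of each stack is its leftmost cell. *)
Definition flat K (st : store) : seq sym := segs st (rev (iota 0 K)).
Definition above K i : seq nat := rev (iota i.+1 (K - i.+1)).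
Definition below i : seq nat := rev (iota 0 i).

Lemma flat_split K st i : i < K ->
  flat K st = segs st (above K i) ++ sSep :: map bit (st i) ++ segs st (below i).
Proof.
move=> iK; have -> : K = i + (1 + (K - i.+1)) by lia.
rewrite /flat iotaD rev_cat segs_cat iotaD rev_cat segs_cat /above /below /= add0n.
have -> : i + (1 + (K - i.+1)) - i.+1 = K - i.+1 by lia.
by rewrite addn1 -catA /= /segs /= -catA.
Qed.

Lemma segs_upd st i s js : i \notin js -> segs (upd st i s) js = segs st js.
Proof.
move=> ni; rewrite /segs; congr flatten; apply/eq_in_map => j js_j.
by rewrite /upd; case: eqP => // e; move: ni; rewrite -e js_j.
Qed.

Lemma flat_upd K st i s : i < K ->
  flat K (upd st i s) =
    segs st (above K i) ++ sSep :: map bit s ++ segs st (below i).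
Proof.
move=> iK; rewrite (flat_split _ iK) !segs_upd /upd ?eqxx //.
  by rewrite mem_rev mem_iota; lia.
by rewrite mem_rev mem_iota; lia.
Qed.

(** The tape grows and shrinks at its left end, so that the stacks behind the one being changed stay
    in place; [m] counts the explicit blanks left over there by earlier pops. *)
Definition home K m st : tape :=
  (nseq m sBlank, sBlank :: flat K st ++ [:: sBlank]).

Definition at_top K m st i : tape :=
  (rev (segs st (above K i) ++ [:: sSep]) ++ nseq m.+1 sBlank,
   map bit (st i) ++ segs st (below i) ++ [:: sBlank]).

Definition goto K i := TSeq goR (TSeq (trep (K - i.+1) toSep) goR).

Lemma gotoP K m st i : i < K ->
  trun (goto K i) (home K m st) (4 * size (flat K st) + 4) (at_top K m st i).
Proof.
move=> iK; rewrite /goto /home (flat_split _ iK) -catA /= -catA.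
have -> : K - i.+1 = size (above K i) by rewrite size_rev size_iota.
apply: trun_le (trun_seq (goRP _ _ _) (trun_seq (toSep_segs _ _ _ _) _)); last first.
  rewrite /at_top rev_cat /=; exact: goRP.
rewrite !size_cat; lia.
Qed.

Lemma scanned_top K m st i : unbit (scanned (at_top K m st i)) = ohead (st i).
Proof.
rewrite /scanned /at_top /=; case: (st i) => [|[|] s] //=.
by rewrite /below; case: (rev _).
Qed.

Lemma at_top_home K m st i : i < K ->
  trun toBlank (at_top K m st i) (4 * size (flat K st) + 4) (home K m st).
Proof.
move=> iK; rewrite /at_top /home.
have e : flat K st ++ [:: sBlank] = (segs st (above K i) ++ [:: sSep]) ++
     (map bit (st i) ++ segs st (below i) ++ [:: sBlank]).
  by rewrite (flat_split _ iK) -!catA /= -catA.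
have : size (map bit (st i) ++ segs st (below i) ++ [:: sBlank]) != 0.
  by rewrite !size_cat /=; lia.
have se : size (segs st (above K i) ++ [:: sSep]) <= size (flat K st).
  by rewrite (flat_split _ iK) !size_cat /=; lia.
rewrite e; case: (_ ++ _ ++ _) => // x r _.
apply: trun_le (toBlankP _ _ _ _); first by lia.
by rewrite all_cat noblank_segs.
Qed.

(** All segments in front of stack [i] move one cell to the left; its separator is rewritten on the
    stale cell, and the old separator cell becomes the new top. *)
Definition tpush K i b :=
  TSeq goR (TSeq (trep (K - i.+1) shift_seg)
    (TSeq goL (TSeq (wr sSep mvR) (TSeq (wr (bit b) mvS) toBlank)))).

Lemma tpushP K m st i b : i < K ->
  trun (tpush K i b) (home K m st) (14 * size (flat K st) + 10)
    (home K m.-1 (upd st i (b :: st i))).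
Proof.
move=> iK; rewrite /tpush /home (flat_upd _ _ iK) (flat_split _ iK) -!catA /= -!catA.
have -> : K - i.+1 = size (above K i) by rewrite size_rev size_iota.
have [y' h] := shift_segs st (above K i) sBlank (nseq m sBlank)
  (map bit (st i) ++ segs st (below i) ++ [:: sBlank]).
have nb : all (predC1 sBlank) (segs st (above K i) ++ [:: sSep]).
  by rewrite all_cat noblank_segs.
have h2 := toBlankP m (bit b)
  (map bit (st i) ++ segs st (below i) ++ [:: sBlank]) nb.
rewrite rev_cat /= -catA /= in h2.
apply: trun_le (trun_seq (goRP _ _ _) (trun_seq h (trun_seq (goLP _ _ _ _)
  (trun_seq (wrRP _ _ _ _) (trun_seq (wrSP _ _ _ _) h2))))).
rewrite !size_cat /= !size_cat /=; lia.
Qed.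

(** An empty stack shows a separator or the final blank, both read as [None], and is left alone.
    Otherwise the cells in front of the top move right over it, and the freed first cell is
    blanked. *)
Definition tpop K i :=
  TSeq (goto K i)
    (TIf (fun s => unbit s != None)
       (TSeq shift_back (TSeq goR (wr sBlank mvS))) toBlank).

Lemma tpopP K m st i : i < K ->
  exists m', trun (tpop K i) (home K m st) (14 * size (flat K st) + 20)
    (home K m' (upd st i (behead (st i)))).
Proof.
move=> iK; have hg := gotoP m st iK; have hs := scanned_top K m st i.
have hh := at_top_home m st iK.
case e: (st i) => [|b s].
  have eq1 : upd st i (behead [::]) =1 st.
    by move=> j; rewrite /upd; case: eqP => // ->.
  exists m; have -> : home K m (upd st i (behead [::])) = home K m st.
    by rewrite /home /flat /segs (eq_map (fun j => congr1 seg (eq1 j))).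
  rewrite e /= in hs.
  have h : trun (TIf (fun s => unbit s != None)
       (TSeq shift_back (TSeq goR (wr sBlank mvS))) toBlank) (at_top K m st i)
       (4 * size (flat K st) + 4).+2 (home K m st).
    by apply: trun_if; rewrite hs.
  apply: trun_le (trun_seq hg h); lia.
exists m.+1; rewrite e /= in hs.
have nb : all (predC1 sBlank) (segs st (above K i) ++ [:: sSep]).
  by rewrite all_cat noblank_segs.
have h0 := shift_backP (nseq m sBlank) (bit b)
  (map bit s ++ segs st (below i) ++ [:: sBlank]) nb.
have h : trun (TIf (fun s => unbit s != None)
       (TSeq shift_back (TSeq goR (wr sBlank mvS))) toBlank) (at_top K m st i)
       (9 * size (flat K st) + 4).+2
       (home K m.+1 (upd st i (behead (b :: s)))).
  apply: trun_if; rewrite hs /= /at_top e /home (flat_upd _ _ iK).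
  have := trun_seq h0 (trun_seq (goRP _ _ _) (wrSP sBlank _ _ _)).
  rewrite -!catA /= -!catA; apply: trun_le.
  rewrite (flat_split _ iK) !size_cat /=; lia.
apply: trun_le (trun_seq hg h); lia.
Qed.

(** * A command language on stacks and its compilation *)

Inductive cmd :=
| CSkip
| CPush of nat & bool
| CPop of nat
| CSeq of cmd & cmd
| CIf of pred (option bool) & nat & cmd & cmd
| CWhile of pred (option bool) & nat & cmd.

Inductive cexec : cmd -> store -> nat -> store -> Prop :=
| ESkip st : cexec CSkip st 1 st
| EPush i b st : cexec (CPush i b) st 1 (upd st i (b :: st i))
| EPop i st : cexec (CPop i) st 1 (upd st i (behead (st i)))
| ESeq p q st t st1 t' st2 :
    cexec p st t st1 -> cexec q st1 t' st2 -> cexec (CSeq p q) st (t + t') st2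
| EIfT (P : pred (option bool)) i p q st t st1 : P (ohead (st i)) ->
    cexec p st t st1 -> cexec (CIf P i p q) st t.+1 st1
| EIfF (P : pred (option bool)) i p q st t st1 : ~~ P (ohead (st i)) ->
    cexec q st t st1 -> cexec (CIf P i p q) st t.+1 st1
| EWhileT (P : pred (option bool)) i p st t st1 t' st2 : P (ohead (st i)) ->
    cexec p st t st1 -> cexec (CWhile P i p) st1 t' st2 ->
    cexec (CWhile P i p) st (t + t').+1 st2
| EWhileF (P : pred (option bool)) i p st : ~~ P (ohead (st i)) ->
    cexec (CWhile P i p) st 1 st.

Fixpoint cwf K (p : cmd) : bool :=
  match p with
  | CSkip => true
  | CPush i _ | CPop i => i < K
  | CSeq p q => cwf K p && cwf K q
  | CIf _ i p q => [&& i < K, cwf K p & cwf K q]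
  | CWhile _ i p => (i < K) && cwf K p
  end.

Fixpoint ccomp K (p : cmd) : tprog :=
  match p with
  | CSkip => stay
  | CPush i b => tpush K i b
  | CPop i => tpop K i
  | CSeq p q => TSeq (ccomp K p) (ccomp K q)
  | CIf P i p q => TSeq (goto K i) (TIf (P \o unbit)
       (TSeq toBlank (ccomp K p)) (TSeq toBlank (ccomp K q)))
  | CWhile P i p => TSeq (TWhile (goto K i) (P \o unbit)
       (TSeq toBlank (ccomp K p))) toBlank
  end.

Lemma size_flat_upd K st i s : i < K ->
  size (flat K (upd st i s)) + size (st i) = size (flat K st) + size s.
Proof.
move=> iK; rewrite flat_upd // (flat_split _ iK) !size_cat /= !size_cat !size_map.
lia.
Qed.

Lemma cexec_size K p st t st' : cexec p st t st' -> cwf K p ->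
  size (flat K st') <= size (flat K st) + t.
Proof.
elim=> {p st t st'}
  [st|i b st|i st|p q st t st1 t' st2 _ IHp _ IHq|P i p q st t st1 _ _ IH
  |P i p q st t st1 _ _ IH|P i p st t st1 t' st2 _ _ IHp _ IHw|P i p st _] /=.
- by lia.
- by move=> iK; have /= := size_flat_upd st (b :: st i) iK; lia.
- by move=> iK; have := size_flat_upd st (behead (st i)) iK; rewrite size_behead; lia.
- by case/andP => /IHp ? /IHq ?; lia.
- by case/and3P => _ /IH ? _; lia.
- by case/and3P => _ _ /IH ?; lia.
- by case/andP => iK wp; have := IHp wp; have := IHw; rewrite /= iK wp => /(_ isT); lia.
- by lia.
Qed.

(* The factor [X] bounds the length of the tape during the whole run. *)
Lemma ccompP K p st t st' : cexec p st t st' -> cwf K p ->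
  forall X m, size (flat K st) + t <= X ->
  exists m', trun (ccomp K p) (home K m st) (t * (50 * X)) (home K m' st').
Proof.
elim=> {p st t st'}
  [st|i b st|i st|p q st t st1 t' st2 ep IHp _ IHq|P i p q st t st1 Pt _ IH
  |P i p q st t st1 Pt _ IH|P i p st t st1 t' st2 Pt ep IHp ew IHw|P i p st Pt]
  /= wf X m leX.
- exists m; apply: trun_le (stayP _ _ _); lia.
- exists m.-1; apply: trun_le (tpushP m st b wf); lia.
- have [m' h] := tpopP m st wf; exists m'; apply: trun_le h; lia.
- case/andP: wf => wp wq; have sz := cexec_size ep wp.
  have [m1 h1] := IHp wp X m ltac:(lia).
  have [m2 h2] := IHq wq X m1 ltac:(lia).
  exists m2; apply: trun_le (trun_seq h1 h2); lia.
- case/and3P: wf => iK wp wq.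
  have [m1 h1] := IH wp X m ltac:(lia); exists m1.
  have h2 := trun_seq (at_top_home m st iK) h1.
  have h3 := @trun_if (P \o unbit) _ (TSeq toBlank (ccomp K q))
    (at_top K m st i) _ (home K m1 st1).
  rewrite /= scanned_top Pt in h3.
  apply: trun_le (trun_seq (gotoP m st iK) (h3 _ _ h2)); lia.
- case/and3P: wf => iK wp wq.
  have [m1 h1] := IH wq X m ltac:(lia); exists m1.
  have h2 := trun_seq (at_top_home m st iK) h1.
  have h3 := @trun_if (P \o unbit) (TSeq toBlank (ccomp K p)) _
    (at_top K m st i) _ (home K m1 st1).
  rewrite /= scanned_top (negbTE Pt) in h3.
  apply: trun_le (trun_seq (gotoP m st iK) (h3 _ _ h2)); lia.
- case/andP: (wf) => iK wp; have sz := cexec_size ep wp.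
  have [m1 h1] := IHp wp X m ltac:(lia).
  have [m2 h2] := IHw wf X m1 ltac:(lia).
  exists m2; case: h2 => t2 le2 /= h2.
  (* The induction hypothesis runs the compiled loop together with its closing [toBlank]. The two
     are separated here, so that one more round can be put in front of the loop alone. *)
  inversion h2 as [|a1 a2 a3 ta a5 tb a7 ha hb| | | |]; subst.
  have ha' : trun (TWhile (goto K i) (P \o unbit) (TSeq toBlank (ccomp K p)))
    (home K m1 st1) ta a5 by exists ta.
  have Pt' : (P \o unbit) (scanned (at_top K m st i)) by rewrite /= scanned_top.
  have h3 := trun_whileT (gotoP m st iK) Pt'
     (trun_seq (at_top_home m st iK) h1) ha'.
  have hb' : trun toBlank a5 tb (home K m2 st2) by exists tb.
  apply: trun_le (trun_seq h3 hb'); lia.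
- case/andP: (wf) => iK wp; exists m.
  have Pt' : ~~ (P \o unbit) (scanned (at_top K m st i)) by rewrite /= scanned_top.
  have h3 := trun_whileF (TSeq toBlank (ccomp K p)) (gotoP m st iK) Pt'.
  apply: trun_le (trun_seq h3 (at_top_home m st iK)); lia.
Qed.

(** * Time bounds for commands and unary arithmetic *)

Definition crun p st T st' := exists2 t, t <= T & cexec p st t st'.

Lemma crun_le p st T T' st' : T <= T' -> crun p st T st' -> crun p st T' st'.
Proof. by move=> le [t tT ex]; exists t => //; apply: leq_trans le. Qed.

Lemma crun_ext p st T st1 st2 : st1 =1 st2 -> crun p st T st1 -> crun p st T st2.
Proof. by move=> /functional_extensionality ->. Qed.

Lemma crun_ext0 p st1 st2 T st : st1 =1 st2 -> crun p st2 T st -> crun p st1 T st.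
Proof. by move=> /functional_extensionality ->. Qed.

Lemma crun_skip st : crun CSkip st 1 st.
Proof. by exists 1 => //; constructor. Qed.

Lemma crun_push i b st : crun (CPush i b) st 1 (upd st i (b :: st i)).
Proof. by exists 1 => //; constructor. Qed.

Lemma crun_pop i st : crun (CPop i) st 1 (upd st i (behead (st i))).
Proof. by exists 1 => //; constructor. Qed.

Lemma crun_seq p q st T st1 T' st2 :
  crun p st T st1 -> crun q st1 T' st2 -> crun (CSeq p q) st (T + T') st2.
Proof.
move=> [t tT ex] [t' tT' ex']; exists (t + t'); first by lia.
exact: ESeq ex ex'.
Qed.

Lemma crun_if (P : pred (option bool)) i p q st T st1 :
  (if P (ohead (st i)) then crun p st T st1 else crun q st T st1) ->
  crun (CIf P i p q) st T.+1 st1.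
Proof.
case: ifP => Pt [t tT ex]; exists t.+1 => //; first exact: EIfT.
by apply: EIfF; rewrite ?Pt.
Qed.

(** The invariant [I] is indexed by the number of rounds still to come, which is usually the height
    of the unary register that controls the loop. *)
Lemma crun_while (P : pred (option bool)) i p (I : nat -> store) T n :
  (forall k, k < n -> P (ohead (I k.+1 i)) /\ crun p (I k.+1) T (I k)) ->
  ~~ P (ohead (I 0 i)) -> crun (CWhile P i p) (I n) (n * T.+1 + 1) (I 0).
Proof.
move=> step stop; elim: n step => [|n IH] step.
  by exists 1 => //; apply: EWhileF.
have [Pn [t tT ex]] := step n (ltnSn n).
have [k kn|t' tT' ex'] := IH; first by apply: step; lia.
exists (t + t').+1; first by lia.
exact: EWhileT ex'.
Qed.

Definition nonempty : pred (option bool) := fun o => o != None.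
Definition topT : pred (option bool) := pred1 (Some true).

Ltac upd_tac :=
  let j := fresh "j" in
  move=> j; rewrite /upd;
  repeat match goal with
  | |- context [@eq_op _ ?a ?b] =>
      case: (@eqP _ a b); let H := fresh in move=> H; try subst
  end; try done; try congruence.

Definition cmv t x := CWhile nonempty t (CSeq (CPop t) (CPush x true)).

Lemma cmvP t x st i : t != x -> st t = nseq i true ->
  crun (cmv t x) st (i * 3 + 1) (upd (upd st t [::]) x (nseq i true ++ st x)).
Proof.
move=> /eqP tx et.
pose I k := upd (upd st t (nseq k true)) x (nseq (i - k) true ++ st x).
apply: (@crun_ext0 _ _ (I i)).
  by rewrite /I subnn -et; upd_tac.
have -> : upd (upd st t [::]) x (nseq i true ++ st x) = I 0.
  by rewrite /I subn0.
apply: crun_while => [k ki|]; last by rewrite /I /upd eqxx (introF eqP tx).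
split; first by rewrite /I /upd eqxx (introF eqP tx).
apply: crun_ext (crun_seq (crun_pop _ _) (crun_push _ _ _)).
rewrite /I; have -> : i - k = (i - k.+1).+1 by lia.
by upd_tac.
Qed.

(* Runs [body] as many times as the unary register [x] says; [x] is saved in
   [t] meanwhile and restored at the end. *)
Definition crepeat x t body :=
  CSeq (CWhile nonempty x (CSeq (CPop x) (CSeq (CPush t true) body))) (cmv t x).

(** In the middle of the loop the count is split between [x] and [t]; the body is therefore required
    to work, and to leave both alone, for arbitrary contents [a] and [b]. *)
Lemma crepeatP x t body (S : nat -> store) i T : x != t ->
  (forall k, S k x = nseq i true) -> (forall k, S k t = [::]) ->
  (forall k a b, k < i -> crun body (upd (upd (S k) x a) t b) T
                                    (upd (upd (S k.+1) x a) t b)) ->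
  crun (crepeat x t body) (S 0) (i * (T + 6) + 2) (S i).
Proof.
move=> /eqP xt Sx St step.
pose I k := upd (upd (S (i - k)) x (nseq k true)) t (nseq (i - k) true).
have h1 : crun (CWhile nonempty x (CSeq (CPop x) (CSeq (CPush t true) body)))
   (I i) (i * (1 + (1 + T)).+1 + 1) (I 0).
  apply: crun_while => [k ki|]; last by rewrite /I /upd eqxx (introF eqP xt).
  split; first by rewrite /I /upd eqxx (introF eqP xt).
  apply: crun_seq (crun_pop _ _) (crun_seq (crun_push _ _ _) _).
  have e : i - k = (i - k.+1).+1 by lia.
  have := step (i - k.+1) (nseq k true) (nseq (i - k) true).
  rewrite -e => h; apply: crun_ext0 (h _); last by lia.
  by rewrite /I e; upd_tac.
have h2 : crun (cmv t x) (I 0) (i * 3 + 1) (S i).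
  apply: crun_ext (cmvP (i := i) _ _).
  - by rewrite /I subn0; upd_tac; rewrite ?Sx ?St ?cats0.
  - by rewrite eq_sym; apply/eqP.
  - by rewrite /I subn0 /upd eqxx.
apply: crun_le (crun_seq (crun_ext0 _ h1) h2); first by lia.
by rewrite /I subnn; upd_tac.
Qed.

Definition cadd x t d := crepeat x t (CPush d true).

Lemma caddP x t d st i : x != t -> x != d -> t != d ->
  st x = nseq i true -> st t = [::] ->
  crun (cadd x t d) st (i * 7 + 2) (upd st d (nseq i true ++ st d)).
Proof.
move=> xt /eqP xd /eqP td ex et.
pose S k := upd st d (nseq k true ++ st d).
apply: (@crun_ext0 _ _ (S 0)); first by rewrite /S; upd_tac.
apply: crun_le (crepeatP (S := S) (i := i) (T := 1) _ _ _ _) => //.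
- by move=> k; rewrite /S /upd (introF eqP xd).
- by move=> k; rewrite /S /upd (introF eqP td).
move=> k a b _; apply: crun_ext (crun_push _ _ _).
by move/eqP: xt => xt; rewrite /S; upd_tac.
Qed.

Definition cmv1 a b :=
  CSeq (CIf topT a (CPush b true) (CPush b false)) (CPop a).

Lemma cmv1P a b st x s : a != b -> st a = x :: s ->
  crun (cmv1 a b) st 3 (upd (upd st b (x :: st b)) a s).
Proof.
move=> /eqP ab e.
have h : crun (CIf topT a (CPush b true) (CPush b false)) st 2
   (upd st b (x :: st b)).
  by apply: crun_if; rewrite e; case: x {e} => /=; apply: crun_push.
apply: crun_ext (crun_seq h (crun_pop _ _)).
by upd_tac; rewrite e.
Qed.

(* Reads the entry of index [x * N + y] of the bit string [R]. *)
Definition clookup R x y :=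
  CSeq (crepeat x 7 (cadd 5 8 9)) (CSeq (cadd y 7 9)
  (CSeq (CWhile nonempty 9 (CSeq (CPop 9) (cmv1 R 7)))
  (CSeq (CIf topT R (CPush 6 true) (CPush 6 false))
        (CWhile nonempty 7 (cmv1 7 R))))).

Lemma nseqSr T n (x : T) s : nseq n x ++ x :: s = nseq n.+1 x ++ s.
Proof. by elim: n => //= n ->. Qed.

Lemma clookupP R x y st n i j : R \in [:: 3; 4] -> 10 < x -> 10 < y ->
  i <= n -> j <= n -> i * n + j < size (st R) ->
  st x = nseq i true -> st y = nseq j true -> st 5 = nseq n true ->
  (forall k, k \in [:: 7; 8; 9] -> st k = [::]) ->
  crun (clookup R x y) st (n * (n * 7 + 8) + n * 7 + 9 * (n * n + n) + 10)
    (upd st 6 (nth false (st R) (i * n + j) :: st 6)).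
Proof.
move=> R34 x10 y10 le_i le_j; set m := i * n + j; set L := st R => lt_m ex ey eN et.
have et7 := et 7 isT; have et8 := et 8 isT; have et9 := et 9 isT.
have R7 : R <> 7 by move: R34; rewrite !inE; lia.
have R9 : R <> 9 by move: R34; rewrite !inE; lia.
have R6 : R <> 6 by move: R34; rewrite !inE; lia.
have h1 : crun (crepeat x 7 (cadd 5 8 9)) st (i * (n * 7 + 8) + 2)
   (upd st 9 (nseq (i * n) true)).
  pose S k := upd st 9 (nseq (k * n) true).
  apply: (@crun_ext0 _ _ (S 0)); first by rewrite /S; upd_tac.
  apply: crun_le (crepeatP (S := S) (i := i) (T := n * 7 + 2) _ _ _ _); first by lia.
  - by lia.
  - by move=> k; rewrite /S /upd; case: eqP => //; lia.
  - by move=> k; rewrite /S /upd.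
  move=> k a b _; apply: crun_ext (caddP (i := n) _ _ _ _ _) => //.
  + rewrite /S mulSn nseqD; upd_tac; try lia.
  + by rewrite /S /upd /=; case: eqP => //; lia.
  + by rewrite /S /upd /=; case: eqP => //; lia.
have h2 : crun (cadd y 7 9) (upd st 9 (nseq (i * n) true)) (j * 7 + 2)
   (upd st 9 (nseq m true)).
  apply: crun_ext (caddP (i := j) _ _ _ _ _) => //.
  + by rewrite /m addnC nseqD; upd_tac.
  + by lia.
  + by lia.
  + by rewrite /upd; case: eqP => //; lia.
(* With [k] units left in register 9, the first [m - k] entries of [R] lie reversed on stack 7. At
   [k = 0] the wanted entry is on top of [R]. *)
pose I k := upd (upd (upd st 9 (nseq k true)) R (drop (m - k) L)) 7
              (rev (take (m - k) L)).
have h3 : crun (CWhile nonempty 9 (CSeq (CPop 9) (cmv1 R 7)))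
     (upd st 9 (nseq m true)) (m * (1 + 3).+1 + 1) (I 0).
  apply: (@crun_ext0 _ _ (I m)).
    by rewrite /I subnn drop0 take0; upd_tac.
  apply: crun_while => [k km|]; last first.
    by rewrite /I /upd /=; case: eqP => // e; case: R9.
  split; first by rewrite /I /upd /=; case: eqP => // e; case: R9.
  have e : m - k = (m - k.+1).+1 by lia.
  have lt_k : m - k.+1 < size L by lia.
  apply: crun_seq (crun_pop _ _) _.
  apply: crun_ext (cmv1P (x := nth false L (m - k.+1)) (s := drop (m - k) L) _ _).
  - rewrite /I e (take_nth false) // rev_rcons; upd_tac.
  - exact/eqP.
  - rewrite /I /upd (introF eqP R9) (introF eqP R7) eqxx (drop_nth false) //.
    by rewrite e.
pose st' := upd (I 0) 6 (nth false L m :: st 6).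
have h4 : crun (CIf topT R (CPush 6 true) (CPush 6 false)) (I 0) 2 st'.
  apply: crun_if.
  have -> : I 0 R = nth false L m :: drop m.+1 L.
    by rewrite /I subn0 /upd (introF eqP R7) eqxx (drop_nth false).
  have e6 : I 0 6 = st 6 by rewrite /I /upd /=; case: eqP => // e; case: R6.
  by rewrite /st' -e6; case: (nth false L m) => /=; apply: crun_push.
pose J k := upd (upd (upd st 6 (nth false L m :: st 6)) R (drop k L)) 7
              (rev (take k L)).
have h5 : crun (CWhile nonempty 7 (cmv1 7 R)) st' (m * 3.+1 + 1)
   (upd st 6 (nth false L m :: st 6)).
  apply: (@crun_ext0 _ _ (J m)); first by rewrite /J /st' /I subn0; upd_tac.
  apply: (@crun_ext _ _ _ (J 0)).
    by rewrite /J drop0 take0; upd_tac.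
  apply: crun_while => [k km|]; last by rewrite /J take0.
  have lt_k : k < size L by lia.
  split; first by rewrite /J (take_nth false) // rev_rcons /upd /=.
  apply: crun_ext (cmv1P (x := nth false L k) (s := rev (take k L)) _ _).
  - by rewrite /J (drop_nth false lt_k); upd_tac.
  - by apply/eqP; lia.
  - by rewrite /J (take_nth false) // rev_rcons /upd /=.
apply: crun_le (crun_seq h1 (crun_seq h2 (crun_seq h3 (crun_seq h4 h5)))).
have : i * n <= n * n by rewrite leq_mul2r le_i orbT.
rewrite /m; nia.
Qed.

(** * Evaluation of first-order formulas *)

(** Popping an empty stack does nothing, so removing the units of [x] from a copy of [y] computes
    the truncated difference; it is nonempty exactly when [x] is the smaller one. *)
Definition cless x y :=
  CSeq (cadd x 7 9) (CSeq (cadd y 7 10)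
  (CSeq (CWhile nonempty 9 (CSeq (CPop 9) (CPop 10)))
  (CSeq (CIf nonempty 10 (CPush 6 true) (CPush 6 false))
        (CWhile nonempty 10 (CPop 10))))).

Lemma clessP x y st n i j : 10 < x -> 10 < y -> i <= n -> j <= n ->
  st x = nseq i true -> st y = nseq j true ->
  (forall k, k \in [:: 7; 9; 10] -> st k = [::]) ->
  crun (cless x y) st (n * 19 + 10) (upd st 6 ((i < j) :: st 6)).
Proof.
move=> x10 y10 le_i le_j ex ey et.
have et7 := et 7 isT; have et9 := et 9 isT; have et10 := et 10 isT.
have h1 : crun (cadd x 7 9) st (i * 7 + 2) (upd st 9 (nseq i true)).
  apply: crun_ext (caddP (i := i) _ _ _ _ _) => //; try lia.
  by rewrite et9 cats0.
pose st1 := upd (upd st 9 (nseq i true)) 10 (nseq j true).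
have h2 : crun (cadd y 7 10) (upd st 9 (nseq i true)) (j * 7 + 2) st1.
  apply: crun_ext (caddP (i := j) _ _ _ _ _) => //; try lia.
  - by rewrite /upd et10 cats0.
  - by rewrite /upd; case: eqP => //; lia.
pose I k := upd (upd st 9 (nseq k true)) 10 (nseq (j - (i - k)) true).
have h3 : crun (CWhile nonempty 9 (CSeq (CPop 9) (CPop 10))) st1
    (i * (1 + 1).+1 + 1) (I 0).
  have -> : st1 = I i by rewrite /I subnn subn0.
  apply: crun_while => [k ki|] //; split => //.
  apply: crun_ext (crun_seq (crun_pop _ _) (crun_pop _ _)).
  rewrite /I; have -> : j - (i - k) = (j - (i - k.+1)).-1 by lia.
  by case: (j - _) => [|l]; upd_tac.
pose J k := upd (upd st 6 ((i < j) :: st 6)) 10 (nseq k true).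
have h4 : crun (CIf nonempty 10 (CPush 6 true) (CPush 6 false)) (I 0) 2 (J (j - i)).
  apply: crun_if.
  have -> : I 0 10 = nseq (j - i) true by rewrite /I subn0.
  have -> : nonempty (ohead (nseq (j - i) true)) = (i < j).
    by rewrite -subn_gt0; case: (j - i).
  by rewrite /J; case: (i < j); apply: crun_ext (crun_push _ _ _);
     rewrite /I subn0; upd_tac.
have h5 : crun (CWhile nonempty 10 (CPop 10)) (J (j - i)) ((j - i) * 1.+1 + 1) (J 0).
  apply: crun_while => [k ki|] //; split => //.
  by apply: crun_ext (crun_pop _ _); rewrite /J; upd_tac.
apply: (@crun_ext _ _ _ (J 0)); first by rewrite /J; upd_tac.
apply: crun_le (crun_seq h1 (crun_seq h2 (crun_seq h3 (crun_seq h4 h5)))); lia.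
Qed.

Record regs := Regs { truth : seq bool; outV : seq bool; outE : seq bool; outF : seq bool }.

Definition bits n (R : rel 'I_n) : seq bool :=
  [seq R i j | i <- enum 'I_n, j <- enum 'I_n].

(** Stacks 5, 4, 3 read in tape order are the encoded instance itself, so loading the input only
    adds separators around it. Stacks 7 to 10 are scratch, and the variables start at 11; those not
    in scope read as empty. *)
Definition memory n (adj F : rel 'I_n) (e : seq 'I_n) (s : regs) : store := fun i =>
  match i with
  | 0 => outF s | 1 => outE s | 2 => outV s
  | 3 => bits F | 4 => bits adj | 5 => nseq n true
  | 6 => truth s | 7 | 8 | 9 | 10 => [::]
  | _ => nseq (nth 0 (map val e) (i - 11)) true
  end.

Definition var d := d + 11.

Lemma memory_var n (adj F : rel 'I_n) e s d :
  memory adj F e s (var d) = nseq (nth 0 (map val e) d) true.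
Proof. by rewrite /var addnC /= !subSS subn0. Qed.

Lemma varE k : 10 < k -> k = var (k - 11).
Proof. by rewrite /var; lia. Qed.

Lemma memory_rcons n (adj F : rel 'I_n) e s x :
  memory adj F (rcons e x) s =1 upd (memory adj F e s) (var (size e)) (nseq x true).
Proof.
move=> k; rewrite /upd; case: eqP => [->|ne].
  by rewrite memory_var map_rcons nth_rcons size_map ltnn eqxx.
case: (leqP k 10) => k10; first by move: k k10 {ne}; do 11?case=> //.
rewrite (varE k10) !memory_var map_rcons nth_rcons size_map.
case: ltnP => // le; rewrite nth_default ?size_map //; case: eqP => // ed.
by case: ne; rewrite (varE k10) ed.
Qed.

Lemma nth_flatten_rows (T S : Type) (x0 : T) (y0 : S) (f : S -> seq T) n s k j :
  (forall i, size (f i) = n) -> j < n -> k < size s ->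
  nth x0 (flatten (map f s)) (k * n + j) = nth x0 (f (nth y0 s k)) j.
Proof.
move=> fn jn; elim: s k => //= i s IH [|k] /= ks; rewrite nth_cat fn.
  by rewrite mul0n jn.
by rewrite mulSn; case: ltnP => [|_]; [lia | rewrite -addnA addKn IH].
Qed.

Lemma nth_bits n (R : rel 'I_n) (i j : 'I_n) : nth false (bits R) (i * n + j) = R i j.
Proof.
rewrite /bits (@nth_flatten_rows _ _ false i) ?size_enum_ord // => [|k].
  by rewrite (nth_map i) ?size_enum_ord // !nth_ord_enum.
by rewrite size_map size_enum_ord.
Qed.

Lemma size_bits n (R : rel 'I_n) : size (bits R) = n * n.
Proof. by rewrite size_allpairs size_enum_ord. Qed.

(** The register is popped before the body runs, so the variable takes the values [n - 1] down to 0.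
    Results pushed by the body therefore end up in increasing order. *)
Definition cfor d body :=
  CSeq (cadd 5 7 (var d))
       (CWhile nonempty (var d) (CSeq (CPop (var d)) body)).

Definition cost_for n T := n * (T + 9) + 3.

(** [o k] describes the registers once all values from [k] upwards have been treated. *)
Lemma cforP n (adj F : rel 'I_n) e body (o : nat -> regs) T :
  (forall x : 'I_n, crun body (memory adj F (rcons e x) (o x.+1)) T
                              (memory adj F (rcons e x) (o x))) ->
  crun (cfor (size e) body) (memory adj F e (o n)) (cost_for n T) (memory adj F e (o 0)).
Proof.
move=> step; set d := size e.
have e0 : nth 0 (map val e) d = 0 by rewrite nth_default // size_map.
pose I k := upd (memory adj F e (o k)) (var d) (nseq k true).
have h1 : crun (cadd 5 7 (var d)) (memory adj F e (o n)) (n * 7 + 2) (I n).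
  apply: crun_ext (caddP (i := n) _ _ _ _ _) => //; rewrite ?/var; try lia.
  by rewrite memory_var e0 cats0.
have h2 : crun (CWhile nonempty (var d) (CSeq (CPop (var d)) body)) (I n)
   (n * (1 + T).+1 + 1) (I 0).
  apply: crun_while => [k kn|]; last by rewrite /I /upd eqxx.
  split; first by rewrite /I /upd eqxx.
  apply: crun_seq (crun_pop _ _) _.
  have := step (Ordinal kn); rewrite /=.
  move/(crun_ext (memory_rcons _ _ _ _ _)); apply: crun_ext0 => j.
  by rewrite memory_rcons /I /upd; case: eqP; rewrite ?eqxx.
apply: (@crun_ext _ _ _ (I 0)).
  by move=> j; rewrite /I /upd; case: eqP => // ->; rewrite memory_var e0.
apply: crun_le (crun_seq h1 h2); rewrite /cost_for; lia.
Qed.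

(* First-order formulas over the structure (adj, F, <), with variables
   named by de Bruijn levels. [FRel true] is adj and [FRel false] is F. *)
Inductive fm :=
| FRel of bool & nat & nat
| FLt of nat & nat
| FNot of fm
| FAnd of fm & fm
| FEx of fm.

Fixpoint sat n (adj F : rel 'I_n) (e : seq 'I_n) (phi : fm) : bool :=
  match phi with
  | FRel b i j => match onth e i, onth e j with
      | Some x, Some y => if b then adj x y else F x y
      | _, _ => false
      end
  | FLt i j => match onth e i, onth e j with
      | Some x, Some y => x < y
      | _, _ => false
      end
  | FNot phi => ~~ sat adj F e phi
  | FAnd phi psi => sat adj F e phi && sat adj F e psi
  | FEx phi => [exists x, sat adj F (rcons e x) phi]
  end.

Fixpoint fwf d (phi : fm) : bool :=
  match phi with
  | FRel _ i j | FLt i j => (i < d) && (j < d)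
  | FNot phi => fwf d phi
  | FAnd phi psi => fwf d phi && fwf d psi
  | FEx phi => fwf d.+1 phi
  end.

(** Truth values are passed on stack 6. Under [FEx] the running disjunction lies just below the
    value of the body. *)
Fixpoint feval d (phi : fm) : cmd :=
  match phi with
  | FRel b i j => clookup (if b then 4 else 3) (var i) (var j)
  | FLt i j => cless (var i) (var j)
  | FNot phi => CSeq (feval d phi)
      (CIf topT 6 (CSeq (CPop 6) (CPush 6 false)) (CSeq (CPop 6) (CPush 6 true)))
  | FAnd phi psi => CSeq (feval d phi) (CSeq (feval d psi)
      (CIf topT 6 (CPop 6) (CSeq (CPop 6) (CSeq (CPop 6) (CPush 6 false)))))
  | FEx phi => CSeq (CPush 6 false) (cfor d (CSeq (feval d.+1 phi)
      (CIf topT 6 (CSeq (CPop 6) (CSeq (CPop 6) (CPush 6 true))) (CPop 6))))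
  end.

Fixpoint cost_fm n (phi : fm) : nat :=
  match phi with
  | FRel _ _ _ => n * (n * 7 + 8) + n * 7 + 9 * (n * n + n) + 10
  | FLt _ _ => n * 19 + 10
  | FNot phi => cost_fm n phi + 3
  | FAnd phi psi => cost_fm n phi + cost_fm n psi + 4
  | FEx phi => 1 + cost_for n (cost_fm n phi + 4)
  end.

Definition push_truth b s := Regs (b :: truth s) (outV s) (outE s) (outF s).

Lemma memory6 n (adj F : rel 'I_n) e s l :
  upd (memory adj F e s) 6 l =1 memory adj F e (Regs l (outV s) (outE s) (outF s)).
Proof. by do 12?[case=> //]. Qed.

Definition pop_truth s := Regs (behead (truth s)) (outV s) (outE s) (outF s).

Lemma crun_push6 n (adj F : rel 'I_n) e s b :
  crun (CPush 6 b) (memory adj F e s) 1 (memory adj F e (push_truth b s)).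
Proof. exact: crun_ext (memory6 _ _ _ _ _) (crun_push _ _ _). Qed.

Lemma crun_pop6 n (adj F : rel 'I_n) e s :
  crun (CPop 6) (memory adj F e s) 1 (memory adj F e (pop_truth s)).
Proof. exact: crun_ext (memory6 _ _ _ _ _) (crun_pop _ _). Qed.

Lemma memory_tmp n (adj F : rel 'I_n) e s k : 6 < k <= 10 -> memory adj F e s k = [::].
Proof. by do 11?[case: k => // k]. Qed.

Lemma nth_onth n (e : seq 'I_n) i (x : 'I_n) :
  onth e i = Some x -> nth 0 (map val e) i = x.
Proof. by elim: e i => [|y e IH] [|i] //= => [[->]|/IH]. Qed.

Lemma fevalP n (adj F : rel 'I_n) phi e s : fwf (size e) phi ->
  crun (feval (size e) phi) (memory adj F e s) (cost_fm n phi)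
    (memory adj F e (push_truth (sat adj F e phi) s)).
Proof.
have onthE (e' : seq 'I_n) i : i < size e' -> exists x, onth e' i = Some x.
  by elim: e' i => [|y e' IH] [|i] //= => [_|/IH //]; exists y.
elim: phi e s => [b i j|i j|phi IH|phi IHphi psi IHpsi|phi IH] e s /=.
- case/andP => /onthE[x ex] /onthE[y ey]; rewrite ex ey.
  have lx := ltn_ord x; have ly := ltn_ord y.
  have lt : x * n + y < size (memory adj F e s (if b then 4 else 3)).
    have : size (memory adj F e s (if b then 4 else 3)) = n * n.
      by case: b; apply: size_bits.
    by move=> ->; nia.
  have h := @clookupP (if b then 4 else 3) (var i) (var j) (memory adj F e s) n x y.
  apply: crun_ext (h _ _ _ _ _ lt _ _ _ _); try (by rewrite /var; lia).
  + move=> k; rewrite memory6; congr (memory _ _ _ (Regs (_ :: _) _ _ _) _).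
    by case: b {h lt}; apply: nth_bits.
  + by case: b {h lt}.
  + by rewrite memory_var (nth_onth ex).
  + by rewrite memory_var (nth_onth ey).
  + by [].
  + by move=> k; rewrite !inE => hk; apply: memory_tmp; lia.
- case/andP => /onthE[x ex] /onthE[y ey]; rewrite ex ey.
  have lx := ltn_ord x; have ly := ltn_ord y.
  apply: crun_ext (clessP (n := n) (i := x) (j := y) _ _ _ _ _ _ _);
    try (by rewrite /var; lia).
  + exact: memory6.
  + by rewrite memory_var (nth_onth ex).
  + by rewrite memory_var (nth_onth ey).
  + by move=> k; rewrite !inE => hk; apply: memory_tmp; lia.
- move=> wf; apply: crun_seq (IH _ _ wf) _.
  apply: crun_if; rewrite /=; case: (sat _ _ _ _) => /=;
    exact: crun_seq (crun_pop6 _ _ _ _) (crun_push6 _ _ _ _ _).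
- case/andP => w1 w2; rewrite -addnA.
  apply: crun_seq (IHphi _ s w1) (crun_seq (IHpsi _ _ w2) _).
  apply: crun_if; rewrite /=; case: (sat adj F e psi) => /=.
    rewrite andbT; apply: (@crun_le _ _ 1) => //; exact: crun_pop6.
  rewrite andbF; exact: crun_seq (crun_pop6 _ _ _ _)
    (crun_seq (crun_pop6 _ _ _ _) (crun_push6 _ _ _ _ _)).
- move=> wf.
  (* The partial disjunction ranges over a final segment because the loop descends. *)
  pose o k := push_truth [exists x : 'I_n, (k <= x) && sat adj F (rcons e x) phi] s.
  have h1 : crun (CPush 6 false) (memory adj F e s) 1 (memory adj F e (o n)).
    have -> : o n = push_truth false s.
      congr (push_truth _ _); apply/negbTE.
      by apply/existsPn => x; rewrite leqNgt ltn_ord.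
    exact: crun_push6.
  have e0 : [exists x, sat adj F (rcons e x) phi] =
            [exists x : 'I_n, (0 <= x) && sat adj F (rcons e x) phi] by [].
  rewrite e0; apply: crun_seq h1 (cforP (o := o) _) => x.
  apply: crun_seq.
    have := IH (rcons e x) (o x.+1); rewrite size_rcons; exact.
  have -> : o x = push_truth (sat adj F (rcons e x) phi ||
      [exists y : 'I_n, (x < y) && sat adj F (rcons e y) phi]) s.
    congr (push_truth _ _); apply/existsP/orP => [[y /andP[]]|].
      rewrite leq_eqVlt => /orP[/eqP/val_inj <-|lt] sy; first by left.
      by right; apply/existsP; exists y; rewrite lt.
    case=> [sx|/existsP[y /andP[lt sy]]]; first by exists x; rewrite leqnn.
    by exists y; rewrite (ltnW lt).
  apply: crun_if; rewrite /=; case: (sat _ _ _ _) => /=.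
    exact: crun_seq (crun_pop6 _ _ _ _)
      (crun_seq (crun_pop6 _ _ _ _) (crun_push6 _ _ _ _ _)).
  apply: (@crun_le _ _ 1) => //; exact: crun_pop6.
Qed.

(** * First-order reductions *)

Definition polyb (f : nat -> nat) := exists c k, forall n, f n <= c * n.+1 ^ k.

Lemma polyb_const a : polyb (fun=> a).
Proof. by exists a, 0 => n; rewrite muln1. Qed.

Lemma polyb_id : polyb id.
Proof. by exists 1, 1 => n; rewrite expn1 mul1n. Qed.

Lemma polyb_add f g : polyb f -> polyb g -> polyb (fun n => f n + g n).
Proof.
move=> [c [k hf]] [d [l hg]]; exists (c + d), (k + l) => n.
have h1 : n.+1 ^ k <= n.+1 ^ (k + l) by apply: leq_pexp2l; lia.
have h2 : n.+1 ^ l <= n.+1 ^ (k + l) by apply: leq_pexp2l; lia.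
have := hf n; have := hg n; nia.
Qed.

Lemma polyb_mul f g : polyb f -> polyb g -> polyb (fun n => f n * g n).
Proof.
move=> [c [k hf]] [d [l hg]]; exists (c * d), (k + l) => n.
by rewrite expnD mulnACA leq_mul.
Qed.

Ltac polyb_tac :=
  repeat first [ assumption | apply: polyb_const | apply: polyb_id
               | apply: polyb_add | apply: polyb_mul ].

Lemma polyb_cost_for f : polyb f -> polyb (fun n => cost_for n (f n)).
Proof. by move=> pf; rewrite /cost_for; polyb_tac. Qed.

Lemma polyb_cost_fm phi : polyb (cost_fm^~ phi).
Proof.
elim: phi => [b i j|i j|phi IH|phi IHphi psi IHpsi|phi IH] /=; polyb_tac.
Qed.

Definition ccollect (kp : fm) :=
  cfor 0 (CSeq (feval 1 kp) (CSeq (CIf topT 6 (CPush 2 true) CSkip) (CPop 6))).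

(** De Bruijn levels force the separate formula [kp2]: with two variables in scope the bound
    variables of [kp] would start one level too low. *)
Definition cmatrix (kp2 phi : fm) (out : nat) :=
  cfor 0 (cfor 1 (CSeq (feval 2 kp2)
    (CIf topT 6 (CSeq (CPop 6) (CSeq (feval 2 phi) (cmv1 6 out))) (CPop 6)))).

Definition cmain (no kp kp2 phiE phiF : fm) :=
  CSeq (feval 0 no) (CIf topT 6 (CPush 0 false)
    (CSeq (ccollect kp) (CSeq (cmatrix kp2 phiE 1) (cmatrix kp2 phiF 0)))).

Section Main.
Context (n : nat) (adj F : rel 'I_n).
Local Notation sat := (sat adj F).
Local Notation memory := (memory adj F).

Definition kept_from (kp : fm) k := [seq x <- drop k (enum 'I_n) | sat [:: x] kp].
Definition kept kp := [seq x <- enum 'I_n | sat [:: x] kp].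

Lemma kept_fromS kp (x : 'I_n) :
  kept_from kp x = if sat [:: x] kp then x :: kept_from kp x.+1 else kept_from kp x.+1.
Proof. by rewrite /kept_from (drop_nth x) ?size_enum_ord // nth_ord_enum /=. Qed.

Lemma kept_from0 kp : kept_from kp 0 = kept kp.
Proof. by rewrite /kept_from drop0. Qed.

Lemma kept_fromn kp : kept_from kp n = [::].
Proof. by rewrite /kept_from drop_oversize // size_enum_ord. Qed.

Lemma ccollectP kp s : fwf 1 kp -> outV s = [::] ->
  crun (ccollect kp) (memory [::] s) (cost_for n (cost_fm n kp + 3))
    (memory [::] (Regs (truth s) (nseq (size (kept kp)) true) (outE s) (outF s))).
Proof.
move=> wf V0.
pose o k := Regs (truth s) (nseq (size (kept_from kp k)) true) (outE s) (outF s).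
have -> : memory [::] s = memory [::] (o n) by rewrite /o kept_fromn /= -V0; case: (s).
rewrite -kept_from0; apply: (@cforP _ _ _ [::] _ o) => x.
apply: crun_seq (fevalP (e := [:: x]) _ _ _ wf) _.
apply: (@crun_seq _ _ _ 2 (memory [:: x] (push_truth (sat [:: x] kp) (o x))) 1).
  apply: crun_if; rewrite /= /o kept_fromS; case: (sat _ _) => /=.
    by apply: crun_ext (crun_push _ _ _); do 4?[case=> //].
  exact: crun_skip.
exact: crun_pop6.
Qed.

Definition matrix kp phi := [seq sat [:: x; y] phi | x <- kept kp, y <- kept kp].

Definition set_out out (s : regs) l :=
  if out is 0 then Regs (truth s) (outV s) (outE s) l
  else Regs (truth s) (outV s) l (outF s).

Definition cost_matrix kp2 phi :=
  cost_for n (cost_for n (cost_fm n kp2 + cost_fm n phi + 5)).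

Lemma cmatrixP kp kp2 phi out s : out < 2 -> fwf 2 kp2 -> fwf 2 phi ->
  (forall x y, sat [:: x; y] kp2 = sat [:: x] kp && sat [:: y] kp) ->
  memory [::] s out = [::] ->
  crun (cmatrix kp2 phi out) (memory [::] s) (cost_matrix kp2 phi)
    (memory [::] (set_out out s (matrix kp phi))).
Proof.
move=> out2 wf wf' kpE s0.
pose o k := set_out out s [seq sat [:: x; y] phi | x <- kept_from kp k, y <- kept kp].
have -> : memory [::] s = memory [::] (o n).
  rewrite /o kept_fromn /=; case: out out2 s0 {o} => [|[|]] //= _ <-; by case: (s).
have -> : set_out out s (matrix kp phi) = o 0 by rewrite /o kept_from0.
apply: (@cforP _ _ _ [::] _ o) => x.
(* All rows below [x] in the matrix are complete, and in row [x] the columns from [j] on are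
   present. *)
pose o' j := set_out out s ((if sat [:: x] kp then
   [seq sat [:: x; y] phi | y <- kept_from kp j] else [::]) ++
   [seq sat [:: x; y] phi | x <- kept_from kp x.+1, y <- kept kp]).
have -> : o x.+1 = o' n by rewrite /o /o' kept_fromn; case: ifP.
have -> : o x = o' 0.
  by rewrite /o /o' kept_from0 kept_fromS; case: ifP.
apply: (@cforP _ _ _ [:: x] _ o') => y.
have h1 := fevalP (e := [:: x; y]) adj F (o' y.+1) wf.
rewrite -addnA; apply: crun_seq h1 _; rewrite kpE.
apply: (@crun_le _ _ (cost_fm n phi + 4).+1); first by lia.
apply: crun_if; rewrite /= /o' kept_fromS.
case: (sat [:: x] kp) => /=; last first.
  by apply: crun_le (crun_pop6 _ _ _ _); lia.
case: (sat [:: y] kp) => /=; last first.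
  by apply: crun_le (crun_pop6 _ _ _ _); lia.
set l := _ ++ _.
rewrite addnC -[4]/(1 + 3) -addnA [3 + _]addnC.
apply: crun_seq (crun_pop6 _ _ _ _) (crun_seq (fevalP (e := [:: x; y]) _ _ _ wf') _).
have out6 : 6 != out by lia.
apply: crun_ext (cmv1P out6 _); last by [].
by case: out out2 {s0 o o' out6} @l => [|[|]] // _ l; do 12?[case=> //].
Qed.

Lemma cmainP no kp kp2 phiE phiF :
  fwf 0 no -> fwf 1 kp -> fwf 2 kp2 -> fwf 2 phiE -> fwf 2 phiF ->
  (forall x y, sat [:: x; y] kp2 = sat [:: x] kp && sat [:: y] kp) ->
  crun (cmain no kp kp2 phiE phiF) (memory [::] (Regs [::] [::] [::] [::]))
    (cost_fm n no + (cost_for n (cost_fm n kp + 3) +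
       (cost_matrix kp2 phiE + cost_matrix kp2 phiF)).+1)
    (memory [::] (if sat [::] no then Regs [:: true] [::] [::] [:: false]
       else Regs [:: false] (nseq (size (kept kp)) true)
                 (matrix kp phiE) (matrix kp phiF))).
Proof.
move=> wn wk wk2 wE wF kpE.
apply: crun_seq (fevalP (e := [::]) _ _ _ wn) _.
apply: crun_if; rewrite /=; case: (sat _ _) => /=.
  apply: crun_le (crun_ext _ (crun_push _ _ _)); first by rewrite /cost_for; lia.
  by do 2?[case=> //].
have h1 := ccollectP (s := Regs [:: false] [::] [::] [::]) wk erefl.
have h2 := cmatrixP (kp := kp) (out := 1) (s := Regs [:: false]
  (nseq (size (kept kp)) true) [::] [::]) isT wk2 wE kpE erefl.
have h3 := cmatrixP (kp := kp) (out := 0) (s := Regs [:: false]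
  (nseq (size (kept kp)) true) (matrix kp phiE) [::]) isT wk2 wF kpE erefl.
exact: crun_seq h1 (crun_seq h2 h3).
Qed.

End Main.

(** * Loading the input and delivering the output *)

Lemma map_bit_bits n (R : rel 'I_n) : map bit (bits R) = enc_rel R.
Proof. by rewrite /bits map_allpairs. Qed.

(** Three separators at the end open the output stacks 2, 1, 0. The instance brings those of stacks
    4 and 3 but none in front of its first block, so [K - 5] are added on the left, for stacks 5 up
    to [K - 1]. *)
Definition tinit K :=
  TSeq (TWhile stay (predC1 sBlank) goR)
  (TSeq (trep 3 (wr sSep mvR)) (TSeq (wr sBlank mvS)
  (TSeq toBlank (trep (K - 5) (wr sSep mvL))))).

Lemma trun_scan l (w : seq sym) : all (predC1 sBlank) w ->
  trun (TWhile stay (predC1 sBlank) goR) (l, w) (4 * size w + 2)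
    (rev w ++ l, [:: sBlank]).
Proof.
elim: w l => [|x w IH] l /=.
  by move=> _; apply: (@trun_whileF _ _ _ _ 1) => //; apply: trun_act.
case/andP=> xb /IH h; rewrite rev_cons cat_rcons.
apply: trun_le (trun_whileT (stayP _ _ _) xb (goRP _ _ _) (h _)); lia.
Qed.

Lemma trun_wrL k r : trun (trep k (wr sSep mvL)) ([::], sBlank :: r) k.+1
  ([::], sBlank :: nseq k sSep ++ r).
Proof.
elim: k r => [|k IH] r; first exact: stayP.
have h : trun (wr sSep mvL) ([::], sBlank :: r) 1 ([::], sBlank :: sSep :: r).
  exact: trun_act.
by have := trun_seq h (IH _); rewrite nseqSr.
Qed.

Lemma flat_init K n (adj F : rel 'I_n) : 10 < K ->
  flat K (memory adj F [::] (Regs [::] [::] [::] [::])) =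
    nseq (K - 5) sSep ++ enc_instance adj F ++ nseq 3 sSep.
Proof.
move=> K10; rewrite (@flat_split _ _ 5); last by lia.
set st := memory _ _ _ _.
have -> : segs st (above K 5) = nseq (K - 6) sSep.
  have empty k : 5 < k -> st k = [::].
    case: (leqP k 10) => k10; last by rewrite (varE k10) /st memory_var /= nth_nil.
    by do 11?[case: k k10 => // k k10].
  have -> : nseq (K - 6) sSep = flatten [seq [:: sSep] | _ <- above K 5].
    have -> : K - 6 = size (above K 5) by rewrite size_rev size_iota.
    by elim: (above K 5) => //= j js ->.
  rewrite /segs; congr flatten; apply/eq_in_map => j.
  by rewrite mem_rev mem_iota => hj; rewrite empty //; lia.
have -> : K - 5 = K - 6 + 1 by lia.
rewrite nseqD -catA /=; congr (_ ++ _ :: _).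
by rewrite /segs /= !map_bit_bits map_nseq /enc_instance /= -!catA /= -!catA.
Qed.

Lemma noblank_instance n (adj F : rel 'I_n) :
  all (predC1 sBlank) (enc_instance adj F).
Proof.
rewrite /enc_instance all_cat all_nseq orbT /= all_cat /=.
by rewrite -!map_bit_bits !noblank_bits.
Qed.

Lemma tinitP K n (adj F : rel 'I_n) : 10 < K ->
  trun (tinit K) ([::], enc_instance adj F)
    (8 * size (enc_instance adj F) + K + 40)
    (home K 0 (memory adj F [::] (Regs [::] [::] [::] [::]))).
Proof.
move=> K10; rewrite /home flat_init //; move: (noblank_instance adj F).
move: (enc_instance adj F) => w nb; have h1 := trun_scan [::] nb.
have h2 : trun (trep 3 (wr sSep mvR)) (rev w ++ [::], [:: sBlank]) 4
   (rev (w ++ nseq 3 sSep) ++ [::], [:: sBlank]).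
  have -> : rev (w ++ nseq 3 sSep) ++ [::] = sSep :: sSep :: sSep :: rev w.
    by rewrite rev_cat cats0.
  rewrite cats0.
  exact: (trun_seq (trun_act _ _) (trun_seq (trun_act _ _)
           (trun_seq (trun_act _ _) (trun_act _ _)))).
have nb' : all (predC1 sBlank) (w ++ nseq 3 sSep) by rewrite all_cat nb.
have h3 := toBlankP 0 sBlank [::] nb'.
have h4 := trun_wrL (K - 5) ((w ++ nseq 3 sSep) ++ [:: sBlank]).
rewrite -catA.
apply: trun_le (trun_seq h1 (trun_seq h2 (trun_seq (wrSP _ _ _ _) (trun_seq h3 h4)))).
rewrite /= !size_cat /=; lia.
Qed.

(** Output is read from the head up to the first blank. A negative answer sits alone on stack 0; a
    kernel starts at the separator of stack 2, which also tells it apart from an answer. *)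
Definition tfinal K :=
  TSeq (goto K 6) (TIf (pred1 s1) (TSeq toBlank (goto K 0))
                       (TSeq toBlank (TSeq (goto K 2) goL))).

Definition output (tp : tape) :=
  take (find (pred1 sBlank) (scanned tp :: behead tp.2)) (scanned tp :: behead tp.2).

Lemma output_noblank l p : all (predC1 sBlank) p -> output (l, p ++ [:: sBlank]) = p.
Proof.
have -> : output (l, p ++ [:: sBlank]) =
  take (find (pred1 sBlank) (p ++ [:: sBlank])) (p ++ [:: sBlank]) by case: p.
move=> nb; rewrite find_cat /=.
have -> : has (pred1 sBlank) p = false.
  by apply/negbTE; rewrite -all_predC.
by rewrite addn0 take_size_cat.
Qed.

Lemma tfinalP K m (st : store) b : 10 < K -> st 6 = [:: b] ->
  exists2 tp, trun (tfinal K) (home K m st) (20 * size (flat K st) + 20) tp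
   & output tp = if b then map bit (st 0) else
       sSep :: map bit (st 2) ++ sSep :: map bit (st 1) ++ sSep :: map bit (st 0).
Proof.
move=> K10 e6.
have K6 : 6 < K by lia.
have K0 : 0 < K by lia.
have K2 : 2 < K by lia.
have h6 := gotoP m st K6.
have b6 := at_top_home m st K6.
have h0 := gotoP m st K0.
have h2 := gotoP m st K2.
have s6 : scanned (at_top K m st 6) = bit b by rewrite /at_top e6.
exists (if b then at_top K m st 0 else
   (rev (segs st (above K 2)) ++ nseq m.+1 sBlank, sSep ::
     map bit (st 2) ++ segs st (below 2) ++ [:: sBlank])).
- have h : trun (TIf (pred1 s1) (TSeq toBlank (goto K 0))
      (TSeq toBlank (TSeq (goto K 2) goL))) (at_top K m st 6)
      (8 * size (flat K st) + 9).+2 (if b then at_top K m st 0 else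
   (rev (segs st (above K 2)) ++ nseq m.+1 sBlank, sSep ::
     map bit (st 2) ++ segs st (below 2) ++ [:: sBlank])).
    apply: trun_if; rewrite s6; case: b {e6 s6} => /=.
      apply: trun_le (trun_seq b6 h0); lia.
    have h : trun goL (at_top K m st 2) 1
       (rev (segs st (above K 2)) ++ nseq m.+1 sBlank, sSep ::
         map bit (st 2) ++ segs st (below 2) ++ [:: sBlank]).
      rewrite /at_top rev_cat.
      case e: (map bit (st 2) ++ segs st (below 2) ++ [:: sBlank]) => [|x r].
        by have := congr1 size e; rewrite !size_cat /=; lia.
      exact: goLP.
    apply: trun_le (trun_seq b6 (trun_seq h2 h)); lia.
  apply: trun_le (trun_seq h6 h); lia.
- case: b {e6 s6}.
    by rewrite /at_top /= output_noblank // noblank_bits.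
  rewrite /segs /= cats0.
  rewrite (_ : sSep :: _ = (sSep :: map bit (st 2) ++ sSep :: map bit (st 1) ++
    sSep :: map bit (st 0)) ++ [:: sBlank]); last by rewrite /= -!catA /= -!catA.
  by rewrite output_noblank //= all_cat /= all_cat /= !noblank_bits.
Qed.

Lemma size_instance n (adj F : rel 'I_n) :
  size (enc_instance adj F) = n + 2 * (n * n) + 2.
Proof.
rewrite /enc_instance !size_cat /= size_cat /= -!map_bit_bits !size_map !size_bits.
by rewrite size_nseq; lia.
Qed.

Definition fo_output n (adj F : rel 'I_n) (no kp phiE phiF : fm) : seq sym :=
  if sat adj F [::] no then [:: s0] else
    sSep :: nseq (size (kept adj F kp)) s1 ++
      sSep :: map bit (matrix adj F kp phiE) ++ sSep :: map bit (matrix adj F kp phiF).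

Theorem fo_reduction_tm K (no kp kp2 phiE phiF : fm) : 10 < K ->
  cwf K (cmain no kp kp2 phiE phiF) ->
  [&& fwf 0 no, fwf 1 kp, fwf 2 kp2, fwf 2 phiE & fwf 2 phiF] ->
  (forall n (adj F : rel 'I_n) x y,
     sat adj F [:: x; y] kp2 = sat adj F [:: x] kp && sat adj F [:: y] kp) ->
  exists (M : TM) (c k : nat), forall n (adj F : rel 'I_n),
    exists2 t, t <= c * (size (enc_instance adj F)).+1 ^ k &
      tm_halts_with M (enc_instance adj F) t (fo_output adj F no kp phiE phiF).
Proof.
move=> K10 wf /and5P[wn wk wk2 wE wF] kpE.
have [M hM] := tm_of_tprog (TSeq (tinit K)
  (TSeq (ccomp K (cmain no kp kp2 phiE phiF)) (tfinal K))).
pose T n := cost_fm n no + (cost_for n (cost_fm n kp + 3) +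
       (cost_matrix n kp2 phiE + cost_matrix n kp2 phiF) + 1).
pose L n := n + 2 * (n * n) + 2.
(* The summands pay for loading, for the commands and for the output. [T n] bounds the number of
   commands, and [K + L n + T n] the length of the tape throughout. *)
pose U n := (8 * L n + K + 40) + (T n * (50 * (K + L n + T n)) +
   (20 * (K + L n + T n) + 20)).
have [c [k hU]] : polyb U.
  have pT : polyb T.
    have pfm phi : polyb (fun n => cost_fm n phi) by exact: polyb_cost_fm.
    have pfor := polyb_cost_for.
    rewrite /T /cost_matrix.
    have p1 := pfm no; have p2 := pfm kp; have p3 := pfm kp2.
    have p4 := pfm phiE; have p5 := pfm phiF.
    by polyb_tac; (apply: pfor; polyb_tac); apply: pfor; polyb_tac.
  have pL : polyb L by rewrite /L; polyb_tac.
  rewrite /U; polyb_tac.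
exists M, c, k => n adj F; set w := enc_instance adj F.
have szw : size w = L n by apply: size_instance.
have h1 := tinitP adj F K10; rewrite -/w szw in h1.
have [t tT ex] := cmainP wn wk wk2 wE wF (kpE n adj F).
set st0 := memory _ _ _ _ in ex h1; set st1 := memory _ _ _ _ in ex.
have sz0 : size (flat K st0) <= K + L n.
  rewrite flat_init // -/w 2!size_cat szw !size_nseq; lia.
have sz1 := cexec_size ex wf.
have tT' : t <= T n by move: tT; rewrite /T; lia.
have [m' h2] := ccompP ex wf (X := K + L n + T n) 0 ltac:(lia).
have e6 : st1 6 = [:: sat adj F [::] no] by rewrite /st1; case: (sat _ _ _ no).
have [tp h3 otp] := tfinalP m' K10 e6.
have [t' tU ext] := trun_seq h1 (trun_seq h2 h3).
exists t'.
  have le1 : t * (50 * (K + L n + T n)) <= T n * (50 * (K + L n + T n)).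
    by rewrite leq_mul2r tT' orbT.
  apply: (@leq_trans (U n)); first by rewrite /U; lia.
  apply: leq_trans (hU n) _; rewrite leq_mul2l; apply/orP; right.
  (* The bound in [n] passes to the instance length, which is at least [n]. *)
  by case: k {hU} => // k; rewrite leq_exp2r // szw /L; lia.
have := hM _ _ _ ext; rewrite -/(output tp) otp.
by rewrite /fo_output /st1; case: (sat _ _ _ no) => /=; rewrite ?map_nseq.
Qed.

(** * Twin classes *)

Definition FOr a b := FNot (FAnd (FNot a) (FNot b)).
Definition FImp a b := FNot (FAnd a (FNot b)).
Definition FIff a b := FAnd (FImp a b) (FImp b a).
Definition FAll a := FNot (FEx (FNot a)).
Definition FEq i j := FAnd (FNot (FLt i j)) (FNot (FLt j i)).
Definition FNe i j := FNot (FEq i j).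

(* In the formulas below [d] is the number of variables in scope. *)
Definition fm_twin d u v :=
  FAll (FImp (FAnd (FNe d u) (FNe d v)) (FIff (FRel true u d) (FRel true v d))).
(** Three twins in increasing order express that the class has three elements. One adjacency test
    decides between clique and independent set, since a class is homogeneous ([class_adj]). *)
Definition fm_big (c : bool) d v :=
  FEx (FEx (FEx (FAnd (FLt d d.+1) (FAnd (FLt d.+1 d.+2)
    (FAnd (if c then FRel true d d.+1 else FNot (FRel true d d.+1))
    (FAnd (fm_twin d.+3 d v) (FAnd (fm_twin d.+3 d.+1 v) (fm_twin d.+3 d.+2 v)))))))).
Definition fm_keep d v :=
  FNot (FEx (FEx (FAnd (FLt d d.+1) (FAnd (FLt d.+1 v)
    (FAnd (fm_twin d.+2 d v) (fm_twin d.+2 d.+1 v)))))).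
(** The closed neighbourhood is the right notion for clique classes: unlike the open one, it is the
    same for all vertices of the class. *)
Definition fm_nbhd v p := FOr (FEq p v) (FRel true v p).
(** [p] and [q] form one colour class of the closed neighbourhood of [v]. The remainder is the other
    one: that it has at most two elements is said by letting any two distinct ones exhaust it, and
    these must not be joined by a forbidden edge either. *)
Definition fm_pairing d v p q :=
  FAnd (fm_nbhd v p) (FAnd (fm_nbhd v q) (FAnd (FNe p q) (FAnd (FNot (FRel false p q))
  (FAll (FAll (FImp
    (FAnd (FAnd (fm_nbhd v d) (FAnd (FNe d p) (FNe d q)))
    (FAnd (FAnd (fm_nbhd v d.+1) (FAnd (FNe d.+1 p) (FNe d.+1 q))) (FNe d d.+1)))
    (FAnd (FNot (FRel false d d.+1))
      (FAll (FImp (fm_nbhd v d.+2)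
        (FOr (FOr (FEq d.+2 p) (FEq d.+2 q)) (FOr (FEq d.+2 d) (FEq d.+2 d.+1))))))))
  )))).
Definition fm_no :=
  FEx (FAnd (fm_big true 1 0) (FNot (FEx (FEx (fm_pairing 3 0 1 2))))).
(** Edges from a big clique class to its outer neighbour stay free even if they lie in [F]: the kept
    vertices need not contain the neighbour's partner in the original graph, and [fm_pairing] has
    already taken account of [F] there. *)
Definition fm_F :=
  FAnd (FRel true 0 1)
    (FOr (FOr (fm_big false 2 0) (fm_big false 2 1))
         (FOr (FAnd (fm_big true 2 0) (fm_twin 2 0 1))
              (FAnd (FRel false 0 1)
                    (FAnd (FNot (fm_big true 2 0)) (FNot (fm_big true 2 1)))))).

(* These shapes make the predicates below convertible to the semantics of the
   corresponding formulas. *)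
Definition bor a b := ~~ (~~ a && ~~ b).
Definition bimp a b := ~~ (a && ~~ b).
Definition biff a b := bimp a b && bimp b a.
Definition ball n (P : pred 'I_n) := ~~ [exists x, ~~ P x].
Definition beq n (x y : 'I_n) := ~~ (x < y) && ~~ (y < x).

Lemma borE a b : bor a b = a || b. Proof. by case: a b => [] []. Qed.
Lemma bimpE a b : bimp a b = (a ==> b). Proof. by case: a b => [] []. Qed.
Lemma biffE a b : biff a b = (a == b). Proof. by case: a b => [] []. Qed.
Lemma ballP n (P : pred 'I_n) : reflect (forall x, P x) (ball P).
Proof.
apply: (iffP existsPn) => h x; first by have := h x; rewrite negbK.
by rewrite negbK.
Qed.
Lemma beqE n (x y : 'I_n) : beq x y = (x == y).
Proof. by rewrite /beq -val_eqE /=; lia. Qed.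

Section Kernel.
Context (n : nat) (adj F : rel 'I_n).
Implicit Types (x y z u v w p q r s t : 'I_n) (col : 'I_n -> bool).

Definition twin x y :=
  ball (fun w => bimp (~~ beq w x && ~~ beq w y) (biff (adj x w) (adj y w))).
Definition big (c : bool) v :=
  [exists x : 'I_n, exists y : 'I_n, exists z : 'I_n, (x < y) && ((y < z) &&
    ((if c then adj x y else ~~ adj x y) && (twin x v && (twin y v && twin z v))))].
Definition keep v :=
  ~~ [exists x : 'I_n, exists y : 'I_n, (x < y) && ((y < v) && (twin x v && twin y v))].
Definition nbhd v p := bor (beq p v) (adj v p).
Definition pairing v p q :=
  nbhd v p && (nbhd v q && (~~ beq p q && (~~ F p q &&
  ball (fun r => ball (fun s => bimp
    ((nbhd v r && (~~ beq r p && ~~ beq r q)) &&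
     ((nbhd v s && (~~ beq s p && ~~ beq s q)) && ~~ beq r s))
    (~~ F r s && ball (fun t => bimp (nbhd v t)
       (bor (bor (beq t p) (beq t q)) (bor (beq t r) (beq t s)))))))))).
Definition good v := [exists p, exists q, pairing v p q].
Definition bad := [exists v, big true v && ~~ good v].
Definition forbid x y :=
  adj x y && bor (bor (big false x) (big false y))
                 (bor (big true x && twin x y)
                      (F x y && (~~ big true x && ~~ big true y))).

Lemma sat_no : sat adj F [::] fm_no = bad. Proof. by []. Qed.

Lemma twinP x y :
  reflect (forall w, w != x -> w != y -> adj x w = adj y w) (twin x y).
Proof.
apply: (iffP (ballP _)) => h w.
  by have := h w; rewrite bimpE biffE !beqE => /implyP h' wx wy; apply/eqP/h'; rewrite wx.
rewrite bimpE biffE !beqE; apply/implyP => /andP[wx wy]; apply/eqP; exact: h.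
Qed.

Lemma bigP c v : reflect (exists x y z, [/\ x < y, y < z, adj x y = c, twin x v &
  twin y v /\ twin z v]) (big c v).
Proof.
apply: (iffP existsP) => [[x /existsP[y /existsP[z]]]|[x [y [z]]]].
  case/and5P=> xy yz a tx /andP[ty tz]; exists x, y, z; split=> //.
  by case: c a => // /negbTE.
case=> xy yz a tx [ty tz]; exists x; apply/existsP; exists y; apply/existsP; exists z.
by rewrite xy yz tx ty tz a; case: (c).
Qed.

Lemma keepPn v : reflect (exists x y, [/\ x < y, y < v, twin x v & twin y v]) (~~ keep v).
Proof.
rewrite negbK; apply: (iffP existsP) => [[x /existsP[y /and4P[]]]|[x [y []]]].
  by exists x, y.
by move=> xy yv tx ty; exists x; apply/existsP; exists y; rewrite xy yv tx.
Qed.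

Lemma nbhdE v p : nbhd v p = (p == v) || adj v p.
Proof. by rewrite /nbhd borE beqE. Qed.

Definition outside v p q r := [&& nbhd v r, r != p & r != q].

Lemma pairingP v p q : reflect [/\ nbhd v p, nbhd v q, p != q, ~~ F p q &
  forall r s, outside v p q r -> outside v p q s -> r != s ->
    ~~ F r s /\ (forall t, nbhd v t -> [|| t == p, t == q, t == r | t == s])]
  (pairing v p q).
Proof.
rewrite /pairing !beqE; apply: (iffP and5P) => -[vp vq pq npq h]; split=> //.
  move=> r s /and3P[vr rp rq] /and3P[vs sp sq] rs.
  move/ballP/(_ r)/ballP/(_ s): h; rewrite bimpE !beqE vr vs rp rq sp sq rs /=.
  case/andP=> -> /ballP h; split=> // t vt.
  by have := h t; rewrite bimpE vt /= !borE !beqE -orbA.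
apply/ballP => r; apply/ballP => s; rewrite bimpE !beqE; apply/implyP.
case/andP=> or /andP[os rs]; have [-> h'] := h r s or os rs.
by apply/ballP => t; rewrite bimpE !borE !beqE -orbA; apply/implyP => /h'.
Qed.

Hypothesis adj_sym : forall x y, adj x y = adj y x.
Hypothesis adj_irr : forall x, adj x x = false.
Hypothesis F_sym : forall x y, F x y = F y x.

Lemma twin_refl x : twin x x. Proof. exact/twinP. Qed.

Lemma twin_sym x y : twin x y = twin y x.
Proof. by apply/twinP/twinP => h w wx wy; rewrite h. Qed.

(** The two hypotheses say nothing directly at [w = y]; there one goes round the triangle,
    [adj x y = adj z x = adj y z], using each hypothesis once. *)
Lemma twin_trans x y z : twin x y -> twin y z -> twin x z.
Proof.
move=> xy yz; have [<-|nxz] := eqVneq x z; first exact: twin_refl.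
have [e|nxy] := eqVneq x y; first by rewrite e.
have [e|nyz] := eqVneq y z; first by rewrite -e.
move/twinP: xy => xy; move/twinP: yz => yz.
apply/twinP => w wx wz; have [->|wy] := eqVneq w y; last by rewrite xy // yz.
have zx : z != x by rewrite eq_sym.
have zy : z != y by rewrite eq_sym.
by rewrite (adj_sym x y) (yz x nxy nxz) (adj_sym z x) (xy z zx zy) adj_sym.
Qed.

Lemma twin_adj x u w : twin x u -> w != x -> adj u w -> w != u -> adj x w.
Proof. by move/twinP => h wx uw wu; rewrite h. Qed.

Lemma twin_adjE v x y z : twin x v -> twin y v -> twin z v ->
  x != y -> x != z -> adj x y = adj x z.
Proof.
move=> tx ty tz xy xz; have [->//|yz] := eqVneq y z.
have /twinP h : twin y z by apply: twin_trans ty _; rewrite twin_sym.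
by rewrite ![adj x _]adj_sym h.
Qed.

(** Endpoints are exchanged one at a time, from [x y] to [x w] to [u w]; only [w = x] needs a
    separate argument. *)
Lemma class_adj v x y u w : twin x v -> twin y v -> twin u v -> twin w v ->
  x != y -> u != w -> adj x y = adj u w.
Proof.
move=> tx ty tu tw xy uw; have [e|wx] := eqVneq w x.
  rewrite -e in xy tx *; rewrite [RHS]adj_sym.
  by apply: (@twin_adjE v) => //; rewrite eq_sym.
rewrite [RHS]adj_sym (@twin_adjE v x y w) // 1?eq_sym //.
by rewrite adj_sym; apply: (@twin_adjE v) => //; rewrite eq_sym.
Qed.

Lemma big_twin c u v : twin u v -> big c u -> big c v.
Proof.
move=> uv /bigP[x [y [z [xy yz a tx [ty tz]]]]]; apply/bigP; exists x, y, z.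
by split=> //; try split; apply: twin_trans uv.
Qed.

Lemma ord_neq x y : x < y -> x != y.
Proof. by move=> h; apply: contraTneq h => ->; rewrite ltnn. Qed.

Lemma big_adj c v u w : big c v -> twin u v -> twin w v -> u != w -> adj u w = c.
Proof.
case/bigP=> x [y [z [xy yz <- tx [ty tz]]]] tu tw uw; apply/esym.
exact: (@class_adj v) (ord_neq xy) uw.
Qed.

Lemma big_excl c c' v : big c v -> big c' v -> c = c'.
Proof.
move=> bc /bigP[x [y [z [xy yz <- tx [ty tz]]]]].
by rewrite (big_adj bc tx ty (ord_neq xy)).
Qed.

Lemma big_nonadj u w : big false u -> twin u w -> ~~ adj u w.
Proof.
move=> b uw; have [->|ne] := eqVneq u w; first by rewrite adj_irr.
by rewrite (big_adj b (twin_refl u) _ ne) // twin_sym.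
Qed.

Lemma nbhd_twin u v p : big true v -> twin u v -> nbhd u p = nbhd v p.
Proof.
move=> b uv; have [->//|ne] := eqVneq u v.
have auv : adj u v by apply: big_adj b uv (twin_refl _) ne.
rewrite !nbhdE; have [->|pu] := eqVneq p u; first by rewrite adj_sym auv orbT.
have [->|pv] := eqVneq p v; first by rewrite auv.
by move/twinP: uv => ->.
Qed.

Lemma nbhd_class u v : big true v -> twin u v -> nbhd v u.
Proof. by move=> b uv; rewrite -(nbhd_twin _ b uv) nbhdE eqxx. Qed.

Lemma good_nbhd_card v : good v -> #|[set x | nbhd v x]| <= 4.
Proof.
case/existsP=> p /existsP[q /pairingP[vp vq pq _ h]].
pose R := [set r | outside v p q r].
have sub1 : [set x | nbhd v x] \subset [set p; q] :|: R.
  apply/subsetP => x; rewrite !inE => vx; rewrite /outside vx /=.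
  by case: (x == p); case: (x == q).
have c2 : #|[set p; q]| = 2 by rewrite cards2 pq.
have [/card_gt1P[r [s [Rr Rs rs]]]|le1] := ltnP 1 #|R|.
  rewrite !inE in Rr Rs; have [_ h'] := h r s Rr Rs rs.
  have sub2 : [set x | nbhd v x] \subset [set p; q] :|: [set r; s].
    by apply/subsetP => x; rewrite !inE => /h'; rewrite -orbA.
  have c2' : #|[set r; s]| = 2 by rewrite cards2 rs.
  have := subset_leq_card sub2; have := cardsU [set p; q] [set r; s]; lia.
have := subset_leq_card sub1; have := cardsU [set p; q] R; lia.
Qed.

(** Three of the at most four places in the closed neighbourhood are taken by the class itself. *)
Lemma good_outer v x y : big true v -> good v -> nbhd v x -> nbhd v y ->
  ~~ twin x v -> ~~ twin y v -> x = y.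
Proof.
move=> b g vx vy tx ty; apply/eqP; apply: contraT => xy.
have [a1 [a2 [a3 [l12 l23 _ t1 [t2 t3]]]]] := bigP _ _ b.
have := good_nbhd_card g; have nt z z' : twin z v -> ~~ twin z' v -> z != z'.
  by move=> tz; apply: contraNneq => <-.
suff h5 : 5 <= #|[set x | nbhd v x]| by move/(leq_trans h5).
have un : uniq [:: a1; a2; a3; x; y].
  rewrite /= !inE !negb_or xy !(nt _ x _ tx) // !(nt _ y _ ty) //.
  by rewrite !ord_neq // (ltn_trans l12).
rewrite -[5]/(size [:: a1; a2; a3; x; y]) -(card_uniqP un).
apply: subset_leq_card; apply/subsetP => z.
rewrite !inE => /or4P[/eqP->|/eqP->|/eqP->|/orP[]/eqP->] //; exact: nbhd_class.
Qed.

(** A twin of an outer neighbour is again an outer neighbour, and there is only one. Its class is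
    thus a singleton, hence never big. *)
Lemma outer_twin v x x' : big true v -> good v -> nbhd v x -> ~~ twin x v ->
  twin x' x -> x' = x.
Proof.
move=> b g vx tx x'x; have tx' : ~~ twin x' v.
  by apply: contra tx; apply: twin_trans; rewrite twin_sym.
apply: (good_outer b g _ vx tx' tx); move: vx; rewrite !nbhdE.
have xv : x != v by apply: contraNneq tx => ->; apply: twin_refl.
have x'v : x' != v by apply: contraNneq tx' => ->; apply: twin_refl.
rewrite (negbTE xv) (negbTE x'v) /= adj_sym => a; rewrite adj_sym.
by apply: twin_adj x'x _ a _; rewrite eq_sym.
Qed.

Lemma outer_nonbig c v x : big true v -> good v -> nbhd v x -> ~~ twin x v ->
  ~~ big c x.
Proof.
move=> b g vx tx; apply/negP => /bigP[a1 [a2 [a3 [l12 _ _ t1 [t2 _]]]]].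
have := ord_neq l12.
by rewrite (outer_twin b g vx tx t1) (outer_twin b g vx tx t2) eqxx.
Qed.

Lemma bigC_bigI u w : good w -> big true w -> big false u -> ~~ adj u w.
Proof.
move=> g bw bu; apply/negP => a.
have tuw : ~~ twin u w.
  by apply/negP => t; have := big_excl (big_twin t bu) bw.
have := outer_nonbig false bw g _ tuw; rewrite bu => /(_ _)/negP; apply=> //.
by rewrite nbhdE adj_sym a orbT.
Qed.

Lemma kept3 x y z : x < y -> y < z -> twin x z -> twin y z -> ~~ keep z.
Proof. by move=> xy yz tx ty; apply/keepPn; exists x, y. Qed.

Lemma nonbig_keep v : ~~ big true v -> ~~ big false v -> keep v.
Proof.
move=> bt bf; apply: contraT => /keepPn[x [y [xy yv tx ty]]].
suff : big (adj x y) v by case: (adj x y); rewrite ?(negbTE bt) ?(negbTE bf).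
by apply/bigP; exists x, y, v; split=> //; split=> //; apply: twin_refl.
Qed.

(** The witnesses are the least vertex of the class and the least of the others. *)
Lemma two_kept v : big true v ->
  exists x y, [/\ x != y, keep x, keep y, twin x v & twin y v].
Proof.
case/bigP=> a [b [c [ab _ _ ta [tb _]]]].
have [x tx minx] := @arg_minnP _ v (twin^~ v) val (twin_refl v).
have [y0 ty0] : exists y0, twin y0 v && (y0 != x).
  have [e|ne] := eqVneq a x; last by exists a; rewrite ta.
  by exists b; rewrite tb -e eq_sym ord_neq.
have [y /andP[ty yx] miny] := @arg_minnP _ y0 (fun y => twin y v && (y != x)) val ty0.
exists x, y; split=> //; first by rewrite eq_sym.
  apply: contraT => /keepPn[z [z' [zz' z'x _ tz']]].
  by have := minx z' (twin_trans tz' tx); rewrite /= leqNgt z'x.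
apply: contraT => /keepPn[z [z' [zz' z'y tz tz']]].
have tzv := twin_trans tz ty; have tzv' := twin_trans tz' ty.
have zx : z = x.
  apply/eqP; apply: contraT => ne; have := miny z; rewrite tzv ne => /(_ isT) /=.
  by rewrite leqNgt (ltn_trans zz' z'y).
have zx' : z' = x.
  apply/eqP; apply: contraT => ne; have := miny z'; rewrite tzv' ne => /(_ isT) /=.
  by rewrite leqNgt z'y.
by move: zz'; rewrite zx zx' ltnn.
Qed.

Lemma exists_kept v : exists x, keep x && twin x v.
Proof.
have [x tx minx] := @arg_minnP _ v (twin^~ v) val (twin_refl v).
exists x; rewrite tx andbT; apply: contraT => /keepPn[z [z' [zz' z'x _ tz']]].
by have := minx z' (twin_trans tz' tx); rewrite /= leqNgt z'x.
Qed.

(** Relativizing to [K] allows the graph and its kernel to be compared on one vertex set; the kept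
    vertices are renumbered only afterwards. *)
Definition valid (K : pred 'I_n) (B : rel 'I_n) col :=
  (forall x y, K x -> K y -> adj x y -> col x = col y -> ~~ B x y) /\
  (forall x y z, K x -> K y -> K z -> adj x y -> adj x z ->
     col x = col y -> col x = col z -> y = z).

(** * From colourings of the graph to colourings of the kernel *)

Section Restrict.
Context (col : 'I_n -> bool).
Hypothesis col_valid : valid predT F col.

Let colF x y : adj x y -> col x = col y -> ~~ F x y.
Proof. exact: col_valid.1. Qed.

Let colU x y z : adj x y -> adj x z -> col x = col y -> col x = col z -> y = z.
Proof. exact: col_valid.2. Qed.

Lemma big_bicolored v b : big true v -> exists2 u, twin u v & col u = b.
Proof.
move=> bv; have [x [y [z [xy yz _ tx [ty tz]]]]] := bigP _ _ bv.
have axy : adj x y by apply: big_adj bv tx ty (ord_neq xy).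
have axz : adj x z by apply: big_adj bv tx tz (ord_neq (ltn_trans xy yz)).
have [e|ne] := eqVneq (col x) b; first by exists x.
have [e|ney] := eqVneq (col y) b; first by exists y.
have [e|nez] := eqVneq (col z) b; first by exists z.
have := ord_neq yz; rewrite (@colU x y z) ?eqxx //.
  by case: (col x) (col y) b ne ney {nez} => [] [] [].
by case: (col x) (col z) b ne nez {ney} => [] [] [].
Qed.

Lemma valid_pairing v x y z : big true v -> twin x v -> twin y v -> twin z v ->
  x != y -> z != x -> z != y -> col x = col y -> pairing v x y.
Proof.
move=> bv tx ty tz xy zx zy cxy.
have axy : adj x y by apply: big_adj bv tx ty xy.
have co r : outside v x y r -> col r = ~~ col x.
  case/and3P=> vr rx ry; case e: (col r == col x); last first.
    by move: e; case: (col r) (col x) => [] [].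
  have xr : adj x r by move: vr; rewrite -(nbhd_twin _ bv tx) nbhdE (negbTE rx).
  by move: ry; rewrite (colU axy xr cxy (esym (eqP e))) eqxx.
have oz : outside v x y z by rewrite /outside nbhd_class // zx.
(* All vertices outside the pair have the colour of [z], and those other than [z] are neighbours of
   [z]; so there is at most one of them. *)
have zo r s : outside v x y r -> outside v x y s -> r != s -> (r == z) || (s == z).
  move=> or os rs; apply: contraT; rewrite negb_or => /andP[rz sz].
  have az p : outside v x y p -> p != z -> adj z p.
    by case/and3P=> vp _ _ pz; move: vp; rewrite -(nbhd_twin _ bv tz) nbhdE (negbTE pz).
  have e : r = s.
    by apply: (colU (az _ or rz) (az _ os sz)); rewrite (co z oz) ?(co r or) ?(co s os).
  by rewrite e eqxx in rs.
apply/pairingP; split=> //; try exact: nbhd_class.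
  exact: colF.
move=> r s or os rs; split.
  apply: colF; last by rewrite (co r or) (co s os).
  have /orP[/eqP e|/eqP e] := zo r s or os rs.
    have /and3P[vs _ _] := os; move: vs.
    by rewrite -(nbhd_twin _ bv tz) nbhdE -e eq_sym (negbTE rs).
  have /and3P[vr _ _] := or; move: vr.
  by rewrite -(nbhd_twin _ bv tz) nbhdE -e (negbTE rs) adj_sym.
move=> t vt; apply: contraT; rewrite !negb_or => /and4P[tx' ty' tr ts].
have ot : outside v x y t by rewrite /outside vt tx'.
have := zo r s or os rs; have := zo t r ot or tr; have := zo t s ot os ts.
case: (eqVneq t z) => [e|_] /=; last first.
  by move=> /eqP e /eqP e'; move: rs; rewrite e e' eqxx.
by rewrite -e in tr ts *; rewrite ![_ == t]eq_sym (negbTE tr) (negbTE ts).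
Qed.

Lemma valid_good v : big true v -> good v.
Proof.
move=> bv; have [x [y [z [xy yz _ tx [ty tz]]]]] := bigP _ _ bv.
have nxy := ord_neq xy; have nyz := ord_neq yz.
have nxz := ord_neq (ltn_trans xy yz).
have g p q r : twin p v -> twin q v -> twin r v -> p != q -> r != p -> r != q ->
    col p = col q -> good v.
  move=> tp tq tr pq rp rq e; apply/existsP; exists p; apply/existsP; exists q.
  exact: (valid_pairing bv tp tq tr).
have [e|nexy] := eqVneq (col x) (col y).
  by apply: (g x y z) => //; rewrite eq_sym.
have [e|nexz] := eqVneq (col x) (col z).
  by apply: (g x z y) => //; rewrite eq_sym.
apply: (g y z x) => //.
by case: (col x) (col y) (col z) nexy nexz => [] [] [].
Qed.

(** Two class vertices share a colour [a], so a common neighbour coloured [a] would have two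
    neighbours of its own colour. That [a] occurs in the class is kept for edges between two
    independent classes. *)
Lemma bigI_nbr v : big false v ->
  exists a, (exists2 u, twin u v & col u = a) /\ forall y, adj v y -> col y = ~~ a.
Proof.
move=> bv; have [x [y [z [xy yz _ tx [ty tz]]]]] := bigP _ _ bv.
have nxy := ord_neq xy; have nyz := ord_neq yz.
have nxz := ord_neq (ltn_trans xy yz).
have g p q : twin p v -> twin q v -> p != q -> col p = col q ->
    exists a, (exists2 u, twin u v & col u = a) /\ forall y, adj v y -> col y = ~~ a.
  move=> tp tq pq e; exists (col p); split; first by exists p.
  move=> w aw; have aw' u : twin u v -> adj w u.
    move=> tu; rewrite adj_sym; apply: (twin_adj tu _ aw).
      apply: contraTneq aw => ->; apply: big_nonadj => //; by rewrite twin_sym.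
    by apply: contraTneq aw => ->; rewrite adj_irr.
  have := @colU w p q (aw' _ tp) (aw' _ tq).
  case: (eqVneq (col w) (col p)) => [ew h|]; last by case: (col w) (col p) => [] [].
  by move: pq; rewrite h ?eqxx // ew.
have [e|nexy] := eqVneq (col x) (col y); first exact: (g x y).
have [e|nexz] := eqVneq (col x) (col z); first exact: (g x z).
apply: (g y z) => //.
by case: (col x) (col y) (col z) nexy nexz => [] [] [].
Qed.

(** In a big clique class the first kept vertex gets [false] and the second [true]. A vertex of a
    big independent class must be opposite to all its neighbours, which agree in colour by
    [bigI_nbr]; without neighbours its colour is arbitrary. *)
Definition restrict_col v : bool :=
  if big true v then [exists u : 'I_n, (u < v) && twin u v]
  else if big false v then (if [pick y | adj v y] is Some y then ~~ col y else true)
  else col v.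

Lemma restrict_col_bigI u w : big false u -> adj u w ->
  restrict_col u <> restrict_col w.
Proof.
move=> bu auw.
have nC v : big false v -> big true v = false.
  by move=> bv; apply/negbTE/negP => bv'; have := big_excl bv bv'.
have val v y : big false v -> adj v y -> restrict_col v = ~~ col y.
  move=> bv avy; rewrite /restrict_col nC // bv.
  have [a [_ ha]] := bigI_nbr bv.
  by case: pickP => [z avz|/(_ y)]; [rewrite !ha | rewrite avy].
rewrite (val u w) //; have [bw|nbw] := boolP (big true w).
  by have := bigC_bigI (valid_good bw) bw bu; rewrite auw.
have [bw'|nbw'] := boolP (big false w); last first.
  by rewrite /restrict_col (negbTE nbw) (negbTE nbw'); case: (col w).
have awu : adj w u by rewrite adj_sym.
rewrite (val w u) //.
(* Both ends lie in big independent classes. The twin [x] of [u] coloured [a] is a neighbour of [w],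
   and all neighbours of [w] agree, so [u] is coloured [a] too, whereas [w] is not. *)
have [a [[x tx cx] ha]] := bigI_nbr bu.
have [a' [_ ha']] := bigI_nbr bw'.
have awx : adj w x.
  rewrite adj_sym; apply: (twin_adj tx _ auw).
    apply: contraTneq auw => ->; apply: big_nonadj => //; by rewrite twin_sym.
  by apply: contraTneq auw => ->; rewrite adj_irr.
by rewrite (ha _ auw) (ha' _ awu) -(ha' _ awx) cx; case: (a).
Qed.

Lemma restrict_col_class u w : big true u -> keep u -> keep w -> twin u w -> u != w ->
  restrict_col u <> restrict_col w.
Proof.
have main x y : big true x -> big true y -> keep y -> twin x y -> x < y ->
    restrict_col x <> restrict_col y.
  move=> bx by_ ky txy xy; rewrite /restrict_col bx by_.
  have -> : [exists u : 'I_n, (u < y) && twin u y].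
    by apply/existsP; exists x; rewrite xy.
  have -> // : [exists u : 'I_n, (u < x) && twin u x] = false.
  apply/negbTE/existsPn => z; apply/negP => /andP[zx tzx].
  by have := kept3 zx xy (twin_trans tzx txy) txy; rewrite ky.
move=> bu ku kw tuw; rewrite -val_eqE neq_ltn => /orP[lt|lt].
  exact: main bu (big_twin tuw bu) kw tuw lt.
by move/esym; apply: main => //; [apply: big_twin bu | rewrite twin_sym].
Qed.

(** A monochromatic kernel edge has no end in a big independent class: it either joins a big clique
    class to an outer neighbour, or was monochromatic before. *)
Lemma restrict_col_mono u w : keep u -> keep w -> adj u w ->
  restrict_col u = restrict_col w ->
  [/\ ~~ big false u, ~~ big false w, big true u -> ~~ twin u w /\ ~~ big true w &
      ~~ big true u -> ~~ big true w -> col u = col w].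
Proof.
move=> ku kw auw e.
have nuw : u != w by apply: contraTneq auw => ->; rewrite adj_irr.
have nu : ~~ big false u by apply/negP => b; apply: restrict_col_bigI b auw e.
have nw : ~~ big false w.
  apply/negP => b; apply: restrict_col_bigI b _ (esym e); by rewrite adj_sym.
split=> //.
  move=> bu; have ntuw : ~~ twin u w.
    by apply/negP => t; apply: restrict_col_class bu ku kw t nuw e.
  split=> //; apply: (outer_nonbig true bu (valid_good bu)).
    by rewrite nbhdE auw orbT.
  by rewrite twin_sym.
move=> bu bw; move: e.
by rewrite /restrict_col (negbTE nu) (negbTE nw) (negbTE bu) (negbTE bw).
Qed.

Lemma restrict_col_valid : valid keep forbid restrict_col.
Proof.
split=> [u w ku kw auw e|u w w' ku kw kw' auw auw' e e'].
  have [nu nw h1 h2] := restrict_col_mono ku kw auw e.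
  rewrite /forbid auw !borE (negbTE nu) (negbTE nw) /=.
  have [bu|bu] := boolP (big true u).
    by have [/negbTE-> _] := h1 bu; rewrite /= andbF.
  have [bw|bw] := boolP (big true w); first by rewrite /= !andbF.
  by rewrite /= andbT; apply: colF => //; apply: h2.
(* Conflicts of an ordinary vertex [u] are traced back to the old colouring: a big clique class
   shows both colours, so one of its vertices agrees with [u]. *)
have mono z : keep z -> adj u z -> restrict_col u = restrict_col z ->
    ~~ big true u -> exists2 x, twin x z & [/\ adj u x, col u = col x &
      ~~ big true z -> x = z].
  move=> kz auz ez bu; have [nu nz h1 h2] := restrict_col_mono ku kz auz ez.
  have [bz|bz] := boolP (big true z); last first.
    by exists z; [apply: twin_refl | split=> //; apply: h2].
  have [x tx cx] := big_bicolored (col u) bz; exists x => //; split=> //.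
  rewrite adj_sym; apply: (twin_adj tx _ _); last 1 first.
  - by apply: contraNneq bu => ->.
  - by apply: contraNneq bu => ->; apply: big_twin bz; rewrite twin_sym.
  - by rewrite adj_sym.
have [bu|bu] := boolP (big true u).
  have [_ _ h1 _] := restrict_col_mono ku kw auw e.
  have [_ _ h1' _] := restrict_col_mono ku kw' auw' e'.
  have [t1 _] := h1 bu; have [t2 _] := h1' bu.
  apply: (good_outer bu (valid_good bu)); rewrite ?nbhdE ?auw ?auw' ?orbT //;
    by rewrite twin_sym.
have [x tx [ax cx ex]] := mono w kw auw e bu.
have [x' tx' [ax' cx' ex']] := mono w' kw' auw' e' bu.
(* Both conflicts lead to the same old one, so [w] and [w'] are twins. In a big clique class
   distinct kept twins differ in colour and cannot both agree with [u]. *)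
have exx := colU ax ax' cx cx'; rewrite -exx in tx' ex' {ax' cx'}.
have tww' : twin w w' by apply: twin_trans tx'; rewrite twin_sym.
apply/eqP; apply: contraT => ne.
have [bw|bw] := boolP (big true w).
  by case: (restrict_col_class bw kw kw' tww' ne); rewrite -e.
have bw' : ~~ big true w' by apply: contra bw; apply: big_twin; rewrite twin_sym.
by move: ne; rewrite -(ex bw) -(ex' bw') eqxx.
Qed.

End Restrict.

(** * From colourings of the kernel to colourings of the graph *)

Section Extend.
Context (col : 'I_n -> bool).
Hypothesis col_valid : valid keep forbid col.
Hypothesis all_good : forall v, big true v -> good v.

Let colF x y : keep x -> keep y -> adj x y -> col x = col y -> ~~ forbid x y.
Proof. exact: col_valid.1. Qed.

Let colU x y z : keep x -> keep y -> keep z -> adj x y -> adj x z ->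
  col x = col y -> col x = col z -> y = z.
Proof. exact: col_valid.2. Qed.

(* [pick] depends only on the extension of its predicate, so twins in a clique
   class choose the same pairing and the same outer neighbour. *)
Definition chosen v : 'I_n * 'I_n :=
  odflt (v, v) [pick pq | pairing v pq.1 pq.2].
Definition side v z := (z == (chosen v).1) || (z == (chosen v).2).
(** The global swap of the two sides that makes the chosen splitting give the outer neighbour the
    colour it has in the kernel. *)
Definition offset v : bool :=
  if [pick x | nbhd v x && ~~ twin x v] is Some x then col x (+) side v x else false.
Definition kept_twin v := odflt v [pick u | keep u && twin u v].
(** A big independent class takes the colour of one kept representative: all kernel edges there are
    forbidden, so that vertex already differs from all its kept neighbours. *)
Definition extend_col v : bool :=
  if big true v then side v v (+) offset v
  else if big false v then col (kept_twin v) else col v.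

Lemma kept_twinP v : keep (kept_twin v) && twin (kept_twin v) v.
Proof.
by rewrite /kept_twin; case: pickP => // h; have [x] := exists_kept v; rewrite h.
Qed.

Lemma chosenP v : big true v -> pairing v (chosen v).1 (chosen v).2.
Proof.
move=> bv; rewrite /chosen; case: pickP => // h.
by have /existsP[p /existsP[q]] := all_good bv; rewrite (h (p, q)).
Qed.

Lemma pairing_twin u v p q : big true v -> twin u v -> pairing u p q = pairing v p q.
Proof.
have imp a b : nbhd a =1 nbhd b -> pairing a p q -> pairing b p q.
  move=> e /pairingP[ap aq pq npq h]; apply/pairingP; split; rewrite -?e // => r s.
  rewrite /outside -!e => hr hs rs; have [nF h'] := h r s hr hs rs.
  by split=> // t; rewrite -e; apply: h'.
move=> bv uv; have e x : nbhd u x = nbhd v x by apply: nbhd_twin.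
by apply/idP/idP; apply: imp.
Qed.

Lemma side_twin u v z : big true v -> twin u v -> side u z = side v z.
Proof.
move=> bv uv; rewrite /side; suff -> : chosen u = chosen v by [].
rewrite {1}/chosen (eq_pick (fun pq => pairing_twin pq.1 pq.2 bv uv)) /chosen.
case: pickP => // h; have := chosenP bv; by rewrite (h (chosen v)).
Qed.

Lemma offset_twin u v : big true v -> twin u v -> offset u = offset v.
Proof.
move=> bv uv; rewrite /offset.
have e : (fun x => nbhd u x && ~~ twin x u) =1 (fun x => nbhd v x && ~~ twin x v).
  move=> x; rewrite (nbhd_twin _ bv uv); congr (_ && ~~ _).
  by apply/idP/idP => h; apply: twin_trans h _; rewrite // twin_sym.
by rewrite (eq_pick e); case: pickP => // x _; rewrite (side_twin _ bv uv).
Qed.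

Lemma extend_col_nonbig v : ~~ big true v -> ~~ big false v ->
  keep v /\ extend_col v = col v.
Proof.
move=> bt bf; split; first exact: nonbig_keep.
by rewrite /extend_col (negbTE bt) (negbTE bf).
Qed.

(** One formula covers the class and its outer neighbour alike, so within a closed neighbourhood
    having the same colour means being on the same side. *)
Lemma extend_col_nbhd v z : big true v -> nbhd v z ->
  extend_col z = side v z (+) offset v.
Proof.
move=> bv vz; have [tz|tz] := boolP (twin z v).
  have bz : big true z by apply: big_twin bv; rewrite twin_sym.
  by rewrite /extend_col bz (side_twin _ bv tz) (offset_twin bv tz).
have gv := all_good bv.
have [_ ->] := extend_col_nonbig (outer_nonbig true bv gv vz tz)
                                 (outer_nonbig false bv gv vz tz).
rewrite /offset; case: pickP => [x /andP[vx tx]|/(_ z)]; last by rewrite vz tz.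
(* The outer neighbour picked by [offset] is [z] itself, and the two occurrences of its side
   cancel. *)
by rewrite (good_outer bv gv vx vz tx tz) addbC addbK.
Qed.

Lemma extend_col_pair v y z : big true v -> nbhd v y -> nbhd v z -> y != z ->
  extend_col y = extend_col z ->
  ~~ F y z /\ forall t, nbhd v t -> t != y -> extend_col y = extend_col t -> t = z.
Proof.
move=> bv vy vz yz.
have inj a b c : a (+) c = b (+) c -> a = b by case: a b c => [] [] [].
rewrite !(extend_col_nbhd bv) // => /inj.
have /pairingP[_ _ pq npq h] := chosenP bv; rewrite /side.
set p := (chosen v).1 in pq npq h *; set q := (chosen v).2 in pq npq h *.
have out t : nbhd v t -> (t == p) || (t == q) = false -> outside v p q t.
  by move=> vt /norP[tp tq]; rewrite /outside vt tp.
(* Either [y] and [z] are the pair [p], [q], or both lie outside it and exhaust the remainder. *)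
case yS: ((y == p) || (y == q)) => /esym zS.
  have tS t : (t == p) || (t == q) -> t != y -> t = if y == p then q else p.
    case/orP: yS => /eqP->; rewrite ?eqxx ?[q == p]eq_sym ?(negbTE pq).
      by case/orP=> /eqP-> //; rewrite eqxx.
    by case/orP=> /eqP-> //; rewrite eqxx.
  have zE := tS z zS; rewrite eq_sym yz in zE; split.
    rewrite zE //; case/orP: yS => /eqP->; first by rewrite eqxx.
    by rewrite [q == p]eq_sym (negbTE pq) F_sym.
  move=> t vt ty; rewrite (extend_col_nbhd bv) // => /inj/esym tS'.
  by rewrite (tS t tS' ty) zE.
have [nF h'] := h y z (out _ vy yS) (out _ vz zS) yz; split=> // t vt ty.
rewrite (extend_col_nbhd bv) // => /inj/esym/norP[tp tq].
have := h' t vt; rewrite (negbTE tp) (negbTE tq) (negbTE ty) /=.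
by move/eqP.
Qed.

(** The edge is moved along twins to one between kept vertices; it is forbidden there, hence not
    monochromatic. *)
Lemma extend_col_bigI u w : big false u -> adj u w -> extend_col u <> extend_col w.
Proof.
move=> bu auw.
have nC v : big false v -> ~~ big true v.
  by move=> bv; apply/negP => bv'; have := big_excl bv bv'.
have bw : ~~ big true w.
  by apply: contraTN auw => bw; apply: bigC_bigI (all_good bw) bw bu.
have adjt x y x' : big false x -> adj x y -> twin x' x -> adj x' y.
  move=> bx axy tx; apply: (twin_adj tx _ axy).
    by apply: contraTneq axy => ->; apply: big_nonadj => //; rewrite twin_sym.
  by apply: contraTneq axy => ->; rewrite adj_irr.
have /andP[ku tu] := kept_twinP u; have /andP[kw tw] := kept_twinP w.
have bu' : big false (kept_twin u) by apply: big_twin bu; rewrite twin_sym.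
have Fu x : adj (kept_twin u) x -> forbid (kept_twin u) x.
  by move=> ax; rewrite /forbid ax !borE bu'.
have au := adjt _ _ _ bu auw tu.
rewrite {1}/extend_col (negbTE (nC _ bu)) bu; have [bw'|bw'] := boolP (big false w).
  rewrite /extend_col (negbTE bw) bw' => e.
  have a : adj (kept_twin u) (kept_twin w).
    by rewrite adj_sym; apply: adjt bw' _ tw; rewrite adj_sym.
  by have := colF ku kw a e; rewrite Fu.
have [kw' ->] := extend_col_nonbig bw bw'.
by move=> e; have := colF ku kw' au e; rewrite Fu.
Qed.

Lemma extend_col_valid : valid predT F extend_col.
Proof.
have nI u w : adj u w -> extend_col u = extend_col w -> ~~ big false u.
  by move=> auw e; apply/negP => bu; apply: extend_col_bigI bu auw e.
have neq u w : adj u w -> u != w.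
  by move=> a; apply: contraTneq a => ->; rewrite adj_irr.
have nb u w : adj u w -> nbhd u w by move=> a; rewrite nbhdE a orbT.
have nb0 u : nbhd u u by rewrite nbhdE eqxx.
split=> [u w _ _ auw e|u w w' _ _ _ auw auw' e e'].
  have awu : adj w u by rewrite adj_sym.
  have [bu|bu] := boolP (big true u).
    by have [] := extend_col_pair bu (nb0 u) (nb _ _ auw) (neq _ _ auw) e.
  have [bw|bw] := boolP (big true w).
    by have [] := extend_col_pair bw (nb _ _ awu) (nb0 w) (neq _ _ auw) e.
  have [ku eu] := extend_col_nonbig bu (nI _ _ auw e).
  have [kw ew] := extend_col_nonbig bw (nI _ _ awu (esym e)).
  have := colF ku kw auw; rewrite -eu -ew => /(_ e); apply: contra => Fuw.
  by rewrite /forbid auw Fuw bu bw !borE !orbT.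
have [bu|bu] := boolP (big true u).
  have [_ h] := extend_col_pair bu (nb0 u) (nb _ _ auw) (neq _ _ auw) e.
  by apply/esym/h => //; [apply: nb | rewrite eq_sym; apply: neq].
have [ku eu] := extend_col_nonbig bu (nI _ _ auw e).
(* This is where the forbidden edge inside a clique class is used: the two kept vertices differ in
   colour, so one of them agrees with [u]. *)
have mono z : adj u z -> extend_col u = extend_col z ->
    exists2 x, twin x z & [/\ keep x, adj u x, col u = col x &
      ~~ big true z -> x = z].
  move=> auz ez; have azu : adj z u by rewrite adj_sym.
  have [bz|bz] := boolP (big true z); last first.
    have [kz ez'] := extend_col_nonbig bz (nI _ _ azu (esym ez)).
    by exists z; [apply: twin_refl | split=> //; rewrite -eu -ez'].
  have [x [y [xy kx ky tx ty]]] := two_kept bz.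
  have ax t : twin t z -> adj u t.
    move=> tt; rewrite adj_sym; apply: (twin_adj tt _ azu).
      by apply: contraNneq bu => ->; apply: big_twin bz; rewrite twin_sym.
    by apply: contraNneq bu => ->.
  have txy : twin x y by apply: twin_trans tx _; rewrite twin_sym.
  have bx : big true x by apply: big_twin bz; rewrite twin_sym.
  have axy : adj x y by apply: big_adj bz tx ty xy.
  have nxy : col x <> col y.
    by move=> c; have := colF kx ky axy c; rewrite /forbid axy !borE bx txy !orbT.
  have [cx|cx] := eqVneq (col u) (col x).
    by exists x => //; split=> //; apply: ax.
  exists y => //; split=> //; first exact: ax.
  by case: (col u) (col x) (col y) nxy cx => [] [] [].
have [x tx [kx ax cx ex]] := mono w auw e.
have [x' tx' [kx' ax' cx' ex']] := mono w' auw' e'.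
have exx := colU ku kx kx' ax ax' cx cx'; rewrite -exx in tx' ex' {kx' ax' cx'}.
have tww' : twin w w' by apply: twin_trans tx'; rewrite twin_sym.
have [bw|bw] := boolP (big true w); last first.
  have bw' : ~~ big true w' by apply: contra bw; apply: big_twin; rewrite twin_sym.
  by rewrite -(ex bw) -(ex' bw').
have awu : adj w u by rewrite adj_sym.
(* Seen from [w], the vertices [u], [w], [w'] all lie in one closed neighbourhood, where [u] has
   only one partner. *)
have [_ h] := extend_col_pair bw (nb _ _ awu) (nb0 w) (neq _ _ auw) e.
apply/esym/h => //; last by rewrite eq_sym; apply: neq.
by apply: nbhd_class => //; rewrite twin_sym.
Qed.

End Extend.

Lemma kernel_equiv : ~~ bad ->
  (exists col, valid predT F col) <-> (exists col, valid keep forbid col).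
Proof.
move=> nb; split=> -[col h]; first by exists (restrict_col col); apply: restrict_col_valid.
exists (extend_col col); apply: extend_col_valid h _ => v bv.
by apply: contraR nb => gv; apply/existsP; exists v; rewrite bv.
Qed.

Lemma bad_invalid col : bad -> ~ valid predT F col.
Proof. by case/existsP=> v /andP[bv /negP gv] h; apply/gv/(valid_good h). Qed.

End Kernel.

(** * The kernel *)

Lemma bip_matching_valid n (adj F : rel 'I_n) : simple_graph adj ->
  has_bip_matching_avoiding adj F <-> exists col, valid adj predT F col.
Proof.
case=> asym airr; split=> [[M [[[Msym Madj] Mfun] [[col colM] MF]]]|[col [cF cU]]].
  have mono x y : adj x y -> col x = col y -> M x y.
    move=> axy e; apply: contraT => nM; have := colM x y axy nM.
    by rewrite e eqxx.
  exists col; split=> [x y _ _ axy e|x y z _ _ _ axy axz e e'].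
    by apply: MF; apply: mono.
  by apply: (Mfun x); apply: mono.
(* Any bipartizing matching for [col] contains all monochromatic edges, so exactly these are
   taken. *)
exists (fun x y => adj x y && (col x == col y)); split; first split; first split.
- by move=> x y; rewrite asym eq_sym.
- by move=> x y /andP[].
- move=> x y z /andP[axy /eqP e] /andP[axz /eqP e']; exact: (cU x).
split; last by move=> x y /andP[axy /eqP e]; apply: cF.
by exists col => x y axy; rewrite axy.
Qed.

Section Enumeration.
Context (n : nat) (adj F : rel 'I_n).
Hypothesis adj_simple : simple_graph adj.
Hypothesis F_edges : edge_subset adj F.

Let asym : forall x y, adj x y = adj y x. Proof. exact: adj_simple.1. Qed.

Definition kernel_vertices : seq 'I_n := [seq x <- enum 'I_n | keep adj x].
Definition kernel_size := size kernel_vertices.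
Definition kernel_vertex (i : 'I_kernel_size) : 'I_n := tnth (in_tuple kernel_vertices) i.
Definition kernel_rel (R : rel 'I_n) : rel 'I_kernel_size :=
  fun i j => R (kernel_vertex i) (kernel_vertex j).

Lemma keep_kernel_vertex i : keep adj (kernel_vertex i).
Proof.
have := mem_tnth i (in_tuple kernel_vertices).
by rewrite /= mem_filter => /andP[].
Qed.

Lemma kernel_vertex_inj : injective kernel_vertex.
Proof. by apply/tuple_uniqP; rewrite /= filter_uniq // enum_uniq. Qed.

Lemma kernel_vertex_surj x : keep adj x -> exists i, x = kernel_vertex i.
Proof.
move=> kx; apply/tnthP; by rewrite /= mem_filter kx mem_enum.
Qed.

Lemma enc_kernel_rel (R : rel 'I_n) : enc_rel (kernel_rel R) =
  map bit [seq R x y | x <- kernel_vertices, y <- kernel_vertices].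
Proof.
have e : kernel_vertices = [seq kernel_vertex i | i <- enum 'I_kernel_size].
  by rewrite /kernel_vertex map_tnth_enum.
by rewrite map_allpairs {1 2}e allpairs_mapl allpairs_mapr.
Qed.

Lemma forbid_sym x y : forbid adj F x y = forbid adj F y x.
Proof.
have Fs : forall x y, F x y = F y x := F_edges.1.
have h u v : forbid adj F u v -> forbid adj F v u.
  rewrite /forbid !borE => /andP[auv]; rewrite asym auv Fs (twin_sym adj v u).
  case/orP=> [|/orP[/andP[bu tuv]|/and3P[-> -> ->]]]; rewrite ?orbT //.
    by rewrite orbC => ->.
  by rewrite tuv (big_twin asym tuv bu) orbT.
by apply/idP/idP; apply: h.
Qed.

Lemma kernel_simple : simple_graph (kernel_rel adj).
Proof.
by split=> [x y|x]; rewrite /kernel_rel; [apply: adj_simple.1 | apply: adj_simple.2].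
Qed.

Lemma kernel_edge_subset : edge_subset (kernel_rel adj) (kernel_rel (forbid adj F)).
Proof.
by split=> [x y|x y]; rewrite /kernel_rel; [apply: forbid_sym | case/andP].
Qed.

Lemma kernel_valid :
  (exists col, valid (kernel_rel adj) predT (kernel_rel (forbid adj F)) col) <->
  (exists col, valid adj (keep adj) (forbid adj F) col).
Proof.
have kk := keep_kernel_vertex; split=> -[col [cF cU]].
  pose col' x := [exists i, (kernel_vertex i == x) && col i].
  have colE i : col' (kernel_vertex i) = col i.
    apply/existsP/idP => [[j /andP[/eqP/kernel_vertex_inj ->]] //|ci].
    by exists i; rewrite eqxx.
  exists col'; split.
    move=> x y /kernel_vertex_surj[i ->] /kernel_vertex_surj[j ->].
    rewrite !colE; exact: cF.
  move=> x y z /kernel_vertex_surj[i ->] /kernel_vertex_surj[j ->].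
  case/kernel_vertex_surj=> l ->; rewrite !colE => h1 h2 h3 h4.
  by congr kernel_vertex; apply: (cU i).
exists (col \o kernel_vertex); split=> [i j _ _|i j l _ _ _ h1 h2 h3 h4].
  exact: cF.
by apply: kernel_vertex_inj; apply: (cU (kernel_vertex i)).
Qed.

Lemma kernel_correct : ~~ bad adj F ->
  has_bip_matching_avoiding adj F <->
  has_bip_matching_avoiding (kernel_rel adj) (kernel_rel (forbid adj F)).
Proof.
move=> nb; rewrite (bip_matching_valid _ adj_simple).
rewrite (bip_matching_valid _ kernel_simple) kernel_valid.
exact: kernel_equiv asym adj_simple.2 F_edges.1 nb.
Qed.

(** The largest of three twins has two predecessors in its class. Of the eight sign patterns two are
    cyclic and impossible. *)
Lemma keep_no3 x y z : keep adj x -> keep adj y -> keep adj z ->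
  twin adj x y -> twin adj y z -> x != y -> y != z -> z != x -> False.
Proof.
move=> kx ky kz xy yz; have xz := twin_trans asym xy yz.
have no a b c : keep adj c -> twin adj a c -> twin adj b c -> a < b -> b < c -> False.
  by move=> kc ac bc ab bc'; have := kept3 ab bc' ac bc; rewrite kc.
have [yx zy zx] : [/\ twin adj y x, twin adj z y & twin adj z x].
  by split; rewrite twin_sym.
rewrite -!val_eqE !neq_ltn => /orP[] h1 /orP[] h2 /orP[] h3.
- by have := ltn_trans (ltn_trans h1 h2) h3; rewrite ltnn.
- exact: (no x y z).
- exact: (no z x y).
- exact: (no x z y).
- exact: (no y z x).
- exact: (no y x z).
- exact: (no z y x).
- by have := ltn_trans (ltn_trans h3 h2) h1; rewrite ltnn.
Qed.

(** Two vertices in one part of an optimal partition are twins, so each part contains at most two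
    kept vertices; optimality of the twin classes themselves does not enter. *)
Lemma kernel_size_nd : kernel_size <= 2 * nd adj.
Proof.
rewrite /nd; case: ex_minnP => t /existsP[f /forallP fP] _.
have twf u w : f u = f w -> twin adj u w.
  move=> e; apply/twinP => v vu vw; have /forallP/(_ u)/forallP/(_ w) := fP v.
  rewrite e eqxx ![_ == v]eq_sym vu vw /= => /eqP h.
  by rewrite asym h asym.
have -> : kernel_size = #|[set x | keep adj x]|.
  rewrite /kernel_size /kernel_vertices cardsE cardE; congr size.
  by rewrite enumT; apply: eq_filter.
rewrite -sum1_card (partition_big f predT) //= mulnC -[t in t * 2]card_ord -sum_nat_const.
apply: leq_sum => i _; rewrite sum1_card leqNgt; apply/card_gt2P.
case=> x [y [z [[]]]]; rewrite -!topredE /= !inE.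
move=> /andP[kx /eqP fx] /andP[ky /eqP fy] /andP[kz /eqP fz] [xy yz zx].
by apply: (keep_no3 kx ky kz) => //; apply: twf; rewrite ?fx ?fy ?fz.
Qed.

End Enumeration.

Theorem mainTheorem15 :
  exists (M : TM) (c k : nat),
  forall (n : nat) (adj F : rel 'I_n),
    simple_graph adj -> edge_subset adj F ->
    let w := enc_instance adj F in
    exists (t : nat) (out : seq sym),
      t <= c * (size w).+1 ^ k /\
      tm_halts_with M w t out /\
      ( (out = [:: s1] /\ has_bip_matching_avoiding adj F)
      \/ (out = [:: s0] /\ ~ has_bip_matching_avoiding adj F)
      \/ (exists (n' : nat) (adj' F' : rel 'I_n'),
            simple_graph adj' /\ edge_subset adj' F' /\
            out = sSep :: enc_instance adj' F' /\
            n' <= 2 * nd adj /\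
            (has_bip_matching_avoiding adj F <->
             has_bip_matching_avoiding adj' F')) ).
Proof.
(* At most six variables are in scope at once, so 17 stacks are used and 20 leave room. The two
   versions of [fm_keep] agree by computation. *)
have [M [c [k hM]]] := @fo_reduction_tm 20 fm_no (fm_keep 1 0)
  (FAnd (fm_keep 2 0) (fm_keep 2 1)) (FRel true 0 1) fm_F isT isT isT
  (fun _ _ _ _ _ => erefl).
exists M, c, k => n adj F sg eF w; have [t tle hw] := hM n adj F.
exists t, (fo_output adj F fm_no (fm_keep 1 0) (FRel true 0 1) fm_F).
(* The machine never gives a positive answer by itself: it rejects or outputs a kernel. *)
do 2!split=> //; right; rewrite /fo_output sat_no.
have [b|nb] := boolP (bad adj F).
  left; split=> //; rewrite (bip_matching_valid _ sg) => -[col].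
  exact: (bad_invalid sg.1 b).
right; exists (kernel_size adj), (kernel_rel adj), (kernel_rel (forbid adj F)).
split; first exact: kernel_simple.
split; first exact: kernel_edge_subset.
split; first by rewrite /enc_instance !enc_kernel_rel.
split; [exact: kernel_size_nd | exact: kernel_correct].
Qed.
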